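(* Let $\Phi$ be a self-concordant function over $\mathcal K$ with constant $M_\Phi>0$, and let $b,\eta,\varepsilon,\alpha>0$ and $m_{\mathrm{Newton}}\in\mathbb N$ be such that $\eta\le \frac{1}{1000\,bM_\Phi}$, $\varepsilon\le\frac{1}{20000M_\Phi}$, $\alpha=0.001$, and $m_{\mathrm{Newton}}=\Theta\big(\log\frac{1}{\varepsilon M_\Phi}\big)$. Further, let $(w_t)$ be the iterates of BARONS with input $(\eta,\varepsilon,\alpha,m_{\mathrm{Newton}})$ and suppose that the corresponding sub-gradients $g_t\in\partial\ell_t(w_t)$ satisfy $\|g_t\|_{\nabla^{-2}\Phi(w_t)}\le b$ for all $t\ge1$. Then, the regret of BARONS is bounded as $$\sum_{t=1}^T(\ell_t(w_t)-\ell_t(w))\lesssim \frac1\eta\Phi(w)+\eta\sum_{t=1}^T\|g_t\|^2_{\nabla^{-2}\Phi(w_t)}+\varepsilon\sum_{t=1}^T\|g_t\|_{\nabla^{-2}\Phi(w_t)},\qquad\forall w\in\operatorname{int}\mathcal K.$$ Furthermore, the computational cost of the algorithm is bounded by $$O\Big((\mathcal C^{\mathrm{grad}}_\varepsilon+d^2)\cdot T\cdot\log\frac1{\varepsilon M_\Phi}+\mathcal C^{\mathrm{hess}}_\alpha\cdot\Big(M_\Phi T\varepsilon+M_\Phi\sum_{t=1}^T\eta\|g_t\|_{\nabla^{-2}\Phi(w_t)}\Big)\Big).$$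
   Context: **Online convex optimization.** $\mathcal K\subset\mathbb R^d$ is a convex compact set with non-empty interior $\operatorname{int}\mathcal K$. At each round $t=1,\dots,T$ the learner plays $w_t\in\mathcal K$ based on the history $\{(\ell_s,w_s)\}_{s<t}$; an adaptive adversary, knowing the history and $w_t$, picks a convex loss $\ell_t:\mathcal K\to\mathbb R$. **Notation.** For a positive definite matrix $A$, $\|x\|_A=\sqrt{x^\top Ax}$. $\nabla^{-2}\Phi=(\nabla^2\Phi)^{-1}$. $f\lesssim g$ means $f\le Cg$ for a universal constant $C>0$; $O(\cdot)$ hides universal constants. $m=\Theta(x)$ means that $m$ is an integer between $c_1x$ and $c_2x$ for suitable universal constants $0<c_1\le c_2$. **Self-concordance.** A convex $C^3$ function $f:\operatorname{int}\mathcal K\to\mathbb R$ is self-concordant with constant $M_f\ge0$ if $f(x_k)\to+\infty$ whenever $x_k\to x\in\partial\mathcal K$, and $|\nabla^3f(x)[u,u,u]|\le2M_f\|u\|^3_{\nabla^2f(x)}$ for all $x\in\operatorname{int}\mathcal K$, $u\in\mathbb R^d$. **Oracles.** The gradient oracle $\mathcal O^{\mathrm{grad}}_\varepsilon(\Phi)$, given $w\in\operatorname{int}\mathcal K$, returns a vector $\widehat\nabla_w$ with $\|\widehat\nabla_w-\nabla\Phi(w)\|_{\nabla^{-2}\Phi(w)}\le\varepsilon$; $\mathcal C^{\mathrm{grad}}_\varepsilon=\mathcal C^{\mathrm{grad}}_\varepsilon(\Phi)$ is the computational cost of one call. The Hessian oracle $\mathcal O^{\mathrm{hess}}_\alpha(\Phi)$,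 given $w\in\operatorname{int}\mathcal K$, returns a matrix $H$ and its inverse $H^{-1}$ with $(1-\alpha)\nabla^2\Phi(w)\preceq H\preceq(1+\alpha)\nabla^2\Phi(w)$ and $(1-\alpha)\nabla^{-2}\Phi(w)\preceq H^{-1}\preceq(1+\alpha)\nabla^{-2}\Phi(w)$; $\mathcal C^{\mathrm{hess}}_\alpha=\mathcal C^{\mathrm{hess}}_\alpha(\Phi)$ is the computational cost of one call. **Algorithm BARONS** (parameters $\eta,\varepsilon,\alpha>0$, $m_{\mathrm{Newton}}\ge1$; gradient and Hessian oracles for the self-concordant function $\Phi$ with constant $M_\Phi>0$; $w^\star\in\arg\min_{w\in\mathcal K}\Phi(w)$). Initialize $u_1=w_1=w^\star$, $H_1=\mathcal O^{\mathrm{hess}}_\alpha(w^\star)$, $s_0=0$. For $t=1,\dots,T$: 1. Play $w_t$, observe $g_t\in\partial\ell_t(w_t)$; set $s_t=s_{t-1}+\eta g_t$ and $w^1_{t+1}=w_t$. 2. For $m=1,\dots,m_{\mathrm{Newton}}-1$: set $\widehat\nabla^m_{t+1}=\mathcal O^{\mathrm{grad}}_\varepsilon(w^m_{t+1})$, $\widetilde\nabla^m_{t+1}=\widehat\nabla^m_{t+1}+s_t$, $w^{m+1}_{t+1}=w^m_{t+1}-H_t^{-1}\widetilde\nabla^m_{t+1}$. 3. Set $w_{t+1}=w^{m_{\mathrm{Newton}}}_{t+1}$. 4. If $\|w_{t+1}-u_t\|_{H_t}\le1/(41M_\Phi)$, set $u_{t+1}=u_t$, $H_{t+1}=H_t$,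 $H_{t+1}^{-1}=H_t^{-1}$. Otherwise set $u_{t+1}=w_{t+1}$ and obtain $H_{t+1},H_{t+1}^{-1}$ from $\mathcal O^{\mathrm{hess}}_\alpha(u_{t+1})$.
   Formalization: In the regret bound Φ(w) is replaced by Φ(w) − Φ(w* ), since the literal bound fails when min Φ < 0; the cost bound has an extra additive term C^hess for the initial Hessian oracle call, which the stated O(·) cannot absorb. *)

(* Defs.v *)
From HB Require Import structures.
From mathcomp Require Import all_boot all_order all_algebra.
From mathcomp Require Import all_classical all_reals all_analysis.

Set Implicit Arguments.
Unset Strict Implicit.
Unset Printing Implicit Defensive.

Import Order.TTheory GRing.Theory Num.Theory.
Import numFieldNormedType.Exports.

Local Open Scope classical_set_scope.
Local Open Scope ring_scope.

Section Calculus.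
Context {R : realType} {d : nat}.
Implicit Types (f : 'cV[R]_d -> R) (U : set 'cV[R]_d) (x u : 'cV[R]_d).

Definition partial (i : 'I_d) f : 'cV[R]_d -> R := 'D_(delta_mx i 0) f.

(* C^k on the open set U: the iterated partial derivatives of order at most k
   exist and are continuous on U.  f is a total function, but as U is open
   only its values on U matter. *)
Fixpoint class_C (k : nat) U f : Prop :=
  (forall x, U x -> {for x, continuous f}) /\
  if k is k'.+1 then
    forall i : 'I_d, (forall x, U x -> derivable f x (delta_mx i 0)) /\
                     class_C k' U (partial i f)
  else True.

Definition gradient f x : 'cV[R]_d := \col_i partial i f x.

Definition hessian f x : 'M[R]_d := \matrix_(i, j) partial i (partial j f) x.

Definition third_derivative f x u : R :=
  \sum_i \sum_j \sum_k
    partial i (partial j (partial k f)) x * u i 0 * u j 0 * u k 0.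

End Calculus.

Section Matrices.
Context {R : realType} {d : nat}.

Definition mxnorm (A : 'M[R]_d) (x : 'cV[R]_d) : R :=
  Num.sqrt ((x^T *m A *m x) 0 0).

Definition possemidef (A : 'M[R]_d) : Prop :=
  A^T = A /\ forall x : 'cV[R]_d, 0 <= (x^T *m A *m x) 0 0.

Definition loewner_le (A B : 'M[R]_d) : Prop := possemidef (B - A).

End Matrices.

Section ConvexOptimization.
Context {R : realType} {d : nat}.
Implicit Types (K : set 'cV[R]_d) (Phi l : 'cV[R]_d -> R) (w g : 'cV[R]_d).

Definition self_concordant K Phi (M : R) : Prop :=
  [/\ convex_function K° Phi,
      class_C 3 K° Phi,
      forall (x_ : nat -> 'cV[R]_d) (x : 'cV[R]_d),
        (forall k, K° (x_ k)) -> x_ @ \oo --> x -> (closure K `\` K°) x ->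
        (Phi \o x_) @ \oo --> +oo &
      forall x u, K° x ->
        `|third_derivative Phi x u| <= 2 * M * mxnorm (hessian Phi x) u ^+ 3].

Definition subgradient K l w g : Prop :=
  forall v, K v -> l w + (g^T *m (v - w)) 0 0 <= l v.

(* The norms ||.||_{hess Phi(w)^-1}. *)
Definition dual_norm Phi w g : R := mxnorm (invmx (hessian Phi w)) g.

(* Phi is only finite on the interior of K, so this is argmin_K Phi. *)
Definition is_minimizer K Phi w : Prop :=
  K° w /\ forall v, K° v -> Phi w <= Phi v.

(* An oracle is indexed by the call (round t, inner iteration m), so that two
   calls at the same point may receive different answers.  Nothing is assumed
   about queries outside the interior of K. *)
Definition is_grad_oracle K Phi (eps : R)
    (O : nat -> nat -> 'cV[R]_d -> 'cV[R]_d) : Prop :=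
  forall t m w, K° w -> dual_norm Phi w (O t m w - gradient Phi w) <= eps.

Definition is_hess_oracle K Phi (alpha : R)
    (O : nat -> 'cV[R]_d -> 'M[R]_d * 'M[R]_d) : Prop :=
  forall t w, K° w ->
    let: (H, Hinv) := O t w in
    let D := hessian Phi w in
    [/\ H *m Hinv = 1%:M,
        loewner_le ((1 - alpha) *: D) H,
        loewner_le H ((1 + alpha) *: D),
        loewner_le ((1 - alpha) *: invmx D) Hinv &
        loewner_le Hinv ((1 + alpha) *: invmx D)].

End ConvexOptimization.

(* A computation returning a value together with its cost.  The cost model is
   the real RAM: each scalar arithmetic operation, square root or comparison
   costs 1, oracle calls have a prescribed cost, and nothing else is charged. *)
Section Cost.
Context {R : realType}.

Definition costly (A : Type) : Type := (A * R)%type.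

Definition cret (A : Type) (a : A) : costly A := (a, 0).

Definition cbind (A B : Type) (x : costly A) (k : A -> costly B) : costly B :=
  ((k x.1).1, x.2 + (k x.1).2).

End Cost.

Notation "'let*' x := e 'in' k" := (cbind e (fun x => k))
  (at level 200, x name, e at level 200, k at level 200,
   format "'[v' 'let*'  x  :=  e  'in' '/' k ']'").

Section Flops.
Context {R : realType} {d : nat}.
Implicit Types (x y : 'cV[R]_d) (A : 'M[R]_d).

Definition c_add x y : costly (R := R) 'cV[R]_d := (x + y, d%:R).
Definition c_sub x y : costly (R := R) 'cV[R]_d := (x - y, d%:R).
Definition c_scale (a : R) x : costly (R := R) 'cV[R]_d := (a *: x, d%:R).
Definition c_mul A x : costly (R := R) 'cV[R]_d :=
  (A *m x, (d * (2 * d - 1))%:R).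
Definition c_dot x y : costly (R := R) R := ((x^T *m y) 0 0, (2 * d - 1)%:R).
Definition c_sqrt (a : R) : costly (R := R) R := (Num.sqrt a, 1).
Definition c_le (a b : R) : costly (R := R) bool := (a <= b, 1).

Definition c_norm A x : costly (R := R) R :=
  let* y := c_mul A x in
  let* q := c_dot x y in
  c_sqrt q.

End Flops.

Section Barons.
Context {R : realType} {d : nat}.

(* The state at the start of round t = 1, 2, ... is s_{t-1}, w_t, u_t, H_t and
   H_t^{-1}. *)
Record barons_state := BaronsState {
  st_s : 'cV[R]_d;
  st_w : 'cV[R]_d;
  st_u : 'cV[R]_d;
  st_H : 'M[R]_d;
  st_Hinv : 'M[R]_d }.

Variables (Ograd : nat -> nat -> 'cV[R]_d -> 'cV[R]_d)
          (Ohess : nat -> 'cV[R]_d -> 'M[R]_d * 'M[R]_d)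
          (Cgrad Chess : R) (eta M : R) (mNewton : nat)
          (wstar : 'cV[R]_d) (g : nat -> 'cV[R]_d).

Definition call_grad (t m : nat) (w : 'cV[R]_d) : costly (R := R) 'cV[R]_d :=
  (Ograd t m w, Cgrad).

Definition call_hess (t : nat) (w : 'cV[R]_d) :
  costly (R := R) ('M[R]_d * 'M[R]_d) := (Ohess t w, Chess).

(* w^{n+1}_{t+1}, i.e. the result of n quasi-Newton steps from w. *)
Fixpoint newton (t : nat) (Hinv : 'M[R]_d) (s w : 'cV[R]_d) (n : nat) :
    costly (R := R) 'cV[R]_d :=
  if n is n'.+1 then
    let* v := newton t Hinv s w n' in
    let* ghat := call_grad t n' v in
    let* gtilde := c_add ghat s in
    let* p := c_mul Hinv gtilde in
    c_sub v p
  else cret w.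

Definition barons_init : costly (R := R) barons_state :=
  let* HH := call_hess 0 wstar in
  cret (BaronsState 0 wstar wstar HH.1 HH.2).

Definition barons_round (t : nat) (st : barons_state) :
    costly (R := R) barons_state :=
  let* step := c_scale eta (g t) in
  let* s := c_add (st_s st) step in
  let* w := newton t (st_Hinv st) s (st_w st) (mNewton - 1) in
  let* delta := c_sub w (st_u st) in
  let* r := c_norm (st_H st) delta in
  let* keep := c_le r (1 / (41 * M)) in
  if keep then cret (BaronsState s w (st_u st) (st_H st) (st_Hinv st))
  else
    let* HH := call_hess t.+1 w in
    cret (BaronsState s w w HH.1 HH.2).

(* In the remaining definitions rounds are numbered from 0: g t is the subgradient revealed in round t, and
   barons_run t is the computation up to the start of round t.  As it depends
   only on g 0, ..., g (t - 1), letting g range over all sequences whose terms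
   are subgradients at the points actually played covers adaptive
   adversaries. *)
Fixpoint barons_run (t : nat) : costly (R := R) barons_state :=
  if t is t'.+1 then
    let* st := barons_run t' in
    barons_round t' st
  else barons_init.

Definition barons_iterate (t : nat) : 'cV[R]_d := st_w (barons_run t).1.

Definition barons_cost (T : nat) : R := (barons_run T).2.

End Barons.

(* Main.v *)
Require Import Defs.
From HB Require Import structures.
From mathcomp Require Import all_boot all_order all_algebra.
From mathcomp Require Import all_classical all_reals all_analysis.
From mathcomp Require Import ring lra.

Set Implicit Arguments.
Unset Strict Implicit.
Unset Printing Implicit Defensive.

Import Order.TTheory GRing.Theory Num.Theory.
Import numFieldNormedType.Exports.

Local Open Scope classical_set_scope.
Local Open Scope ring_scope.

(** Let [x_t] be the exact minimizer of [Phi + <s_t, .>], where [s_t] is [eta] times the sum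
    of the gradients of the rounds before [t]; so [x_0] is the minimizer of [Phi]. The
    proof shows that [w_t] stays within [O (eps)] of [x_t] in the local norm, and reads
    off both bounds.

    Regret. Let [F_t] be the minimum of [Phi + <s_t, .>]. As [x_t] minimizes the objective
    of round [t], [F_(t+1) >= F_t + eta <g_t, x_(t+1)>]. Summing up, and comparing with
    [F_T <= Phi v + <s_T, v>], bounds the regret of the sequence [x_(t+1)] by
    [(Phi v - Phi wstar) / eta]. Playing [w_t] instead costs
    [<g_t, w_t - x_t> + <g_t, x_t - x_(t+1)>], that is [O (eps |g_t| + eta |g_t| ^ 2)]
    in the dual norm, because strong convexity gives
    [|x_t - x_(t+1)| = O (eta |g_t|)] ([round_tracking]).

    Geometry. All of this takes place in balls of radius a small multiple of [1 / M] in a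
    local norm, where the Hessian is nearly constant ([dikin]). That follows from a bound
    on the third derivative [T v h h] for two different directions. Self-concordance only
    bounds the diagonal [T u u u]; since [T] is symmetric by Schwarz's theorem
    ([mixed_derivatives_commute]), polarization extends the bound with the constant
    [10 / 3] in place of the optimal [2] ([trilinear_le]), which the numerical margins of
    the algorithm absorb. The same ball provides [x_(t+1)]: it is the minimizer of the new
    objective over a ball around [x_t], found to lie strictly inside ([nearby_minimizer]).
    The Hessian is positive definite because an invertible matrix lies between two of its
    multiples ([sandwich_posdef]).

    Tracking. Between two Hessian calls the estimate [H] made at [u] is within a quarter
    of the Hessian at every point that is met, so a quasi-Newton step contracts the
    [H]-distance to [x_(t+1)] by the factor [1 / 4], up to [11 / 10 eps]
    ([inexact_newton_step]). A round starts at a distance [O (1 / M)] from [x_(t+1)], so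
    [ln (1 / (eps M))] steps end within [O (eps)] of it ([newton_converges]).

    Cost. Only the number of Hessian calls needs an argument. One is made when
    [41 M |w - u|_H] exceeds [1], and resets it to [0]; in one round it grows by at most
    [41 M |w_(t+1) - w_t|_H = O (M eps + M eta |g_t|)] ([round_tracks]). *)

(** * Quadratic forms and the norms they define *)

Section LinearAlgebra.
Context {R : realType} {d : nat}.
Implicit Types (A B H : 'M[R]_d) (x y z g : 'cV[R]_d).

Definition bform A x y : R := (x^T *m A *m y) 0 0.

Definition posdef A : Prop :=
  A^T = A /\ forall x, x != 0 -> 0 < bform A x x.

Lemma bformDl A x y z : bform A (x + y) z = bform A x z + bform A y z.
Proof. by rewrite /bform linearD /= !mulmxDl mxE. Qed.

Lemma bformDr A x y z : bform A z (x + y) = bform A z x + bform A z y.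
Proof. by rewrite /bform !mulmxDr mxE. Qed.

Lemma bformZl A c x z : bform A (c *: x) z = c * bform A x z.
Proof. by rewrite /bform linearZ /= -!scalemxAl mxE. Qed.

Lemma bformZr A c x z : bform A z (c *: x) = c * bform A z x.
Proof. by rewrite /bform -!scalemxAr mxE. Qed.

Lemma bformNl A x z : bform A (- x) z = - bform A x z.
Proof. by rewrite -scaleN1r bformZl mulN1r. Qed.

Lemma bformNr A x z : bform A z (- x) = - bform A z x.
Proof. by rewrite -scaleN1r bformZr mulN1r. Qed.

Lemma bform0l A x : bform A 0 x = 0.
Proof. by rewrite -(scale0r 0) bformZl mul0r. Qed.

Lemma bformDm A B x y : bform (A + B) x y = bform A x y + bform B x y.
Proof. by rewrite /bform mulmxDr mulmxDl mxE. Qed.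

Lemma bformNm A x y : bform (- A) x y = - bform A x y.
Proof. by rewrite /bform mulmxN mulNmx mxE. Qed.

Lemma bformZm c A x y : bform (c *: A) x y = c * bform A x y.
Proof. by rewrite /bform -scalemxAr -scalemxAl mxE. Qed.

Lemma bformC A x y : A^T = A -> bform A x y = bform A y x.
Proof.
move=> sA; rewrite /bform; transitivity (((x^T *m A *m y)^T) 0 0).
  by rewrite [RHS]mxE.
by rewrite !trmx_mul sA trmxK mulmxA.
Qed.

Lemma posdef_possemidef A : posdef A -> possemidef A.
Proof.
move=> [sA pA]; split=> // x; have [->|x0] := eqVneq x 0; last exact/ltW/pA.
by rewrite -/(bform A 0 0) bform0l.
Qed.

Lemma possemidef_ge0 A x : possemidef A -> 0 <= bform A x x.
Proof. by case=> _; apply. Qed.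

Lemma mxnorm_ge0 A x : 0 <= mxnorm A x. Proof. exact: sqrtr_ge0. Qed.

Lemma sqr_mxnorm A x : possemidef A -> mxnorm A x ^+ 2 = bform A x x.
Proof. by move=> [_ pA]; rewrite sqr_sqrtr // pA. Qed.

Lemma mxnormZ A c x : mxnorm A (c *: x) = `|c| * mxnorm A x.
Proof.
rewrite /mxnorm -!/(bform _ _ _) bformZl bformZr mulrA -expr2.
by rewrite sqrtrM ?sqr_ge0 // sqrtr_sqr.
Qed.

Lemma mxnormN A x : mxnorm A (- x) = mxnorm A x.
Proof. by rewrite -scaleN1r mxnormZ normrN1 mul1r. Qed.

Lemma mxnorm0 A : mxnorm A 0 = 0.
Proof. by rewrite /mxnorm -/(bform _ _ _) bform0l sqrtr0. Qed.

Lemma mxnormB A x y : mxnorm A (x - y) = mxnorm A (y - x).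
Proof. by rewrite -mxnormN opprB. Qed.

Lemma cauchy_schwarz A x y : possemidef A ->
  `|bform A x y| <= mxnorm A x * mxnorm A y.
Proof.
move=> pA; have [sA nA] := pA.
rewrite -ler_sqr ?nnegrE ?mulr_ge0 ?mxnorm_ge0 // exprMn !sqr_mxnorm //.
rewrite real_normK ?num_real //.
(* The discriminant of the nonnegative quadratic t |-> bform (x + t y) *)
have q t : 0 <= bform A x x + 2 * t * bform A x y + t ^+ 2 * bform A y y.
  have := nA (x + t *: y); rewrite -/(bform _ _ _).
  rewrite !(bformDl, bformDr, bformZl, bformZr) (bformC y x sA); lra.
have yy := nA y; rewrite -/(bform _ _ _) in yy.
have [y0|y0] := eqVneq (bform A y y) 0.
  suff -> : bform A x y = 0 by rewrite expr0n /= y0 mulr0.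
  apply/eqP/negPn/negP => xy0.
  have := q (- (bform A x x + 1) / (2 * bform A x y)).
  rewrite y0 mulr0 addr0.
  suff -> : bform A x x +
     2 * (- (bform A x x + 1) / (2 * bform A x y)) * bform A x y = -1 by lra.
  by field.
have y1 : 0 < bform A y y by rewrite lt_neqAle eq_sym y0.
have := q (- bform A x y / bform A y y).
rewrite -(pmulr_lge0 _ y1) => h.
rewrite -subr_ge0; apply: le_trans h _.
by rewrite le_eqVlt; apply/orP; left; apply/eqP; field.
Qed.

Definition dot x y : R := (x^T *m y) 0 0.

Lemma bform1 x y : bform 1%:M x y = dot x y.
Proof. by rewrite /bform mulmx1. Qed.

Lemma dotDl x y z : dot (x + y) z = dot x z + dot y z.
Proof. by rewrite -!bform1 bformDl. Qed.

Lemma dotDr x y z : dot z (x + y) = dot z x + dot z y.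
Proof. by rewrite -!bform1 bformDr. Qed.

Lemma dotZl c x z : dot (c *: x) z = c * dot x z.
Proof. by rewrite -!bform1 bformZl. Qed.

Lemma dotZr c x z : dot z (c *: x) = c * dot z x.
Proof. by rewrite -!bform1 bformZr. Qed.

Lemma dotNl x z : dot (- x) z = - dot x z.
Proof. by rewrite -!bform1 bformNl. Qed.

Lemma dotNr x z : dot z (- x) = - dot z x.
Proof. by rewrite -!bform1 bformNr. Qed.

Lemma dot0l x : dot 0 x = 0.
Proof. by rewrite -bform1 bform0l. Qed.

Lemma dotC x y : dot x y = dot y x.
Proof. by rewrite -!bform1 bformC ?trmx1. Qed.

Lemma dot_mulmx A x y : dot x (A *m y) = bform A x y.
Proof. by rewrite /dot mulmxA. Qed.

Lemma mxnormD A x y : possemidef A ->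
  mxnorm A (x + y) <= mxnorm A x + mxnorm A y.
Proof.
move=> pA; have [sA _] := pA.
rewrite -ler_sqr ?nnegrE ?addr_ge0 ?mxnorm_ge0 // sqrrD !sqr_mxnorm //.
rewrite !(bformDl, bformDr) (bformC y x sA).
have := cauchy_schwarz x y pA; rewrite ler_norml => /andP[_]; lra.
Qed.

Lemma mxnorm_triangle A x y z : posdef A ->
  mxnorm A (x - z) <= mxnorm A (x - y) + mxnorm A (y - z).
Proof.
move=> pA; have -> : x - z = (x - y) + (y - z) by rewrite addrA subrK.
exact: mxnormD (posdef_possemidef pA).
Qed.

Lemma mxnorm_le A B c x : possemidef A -> possemidef B -> 0 <= c ->
  bform A x x <= c ^+ 2 * bform B x x -> mxnorm A x <= c * mxnorm B x.
Proof.
move=> pA pB c0 h; rewrite -ler_sqr ?nnegrE ?mulr_ge0 ?mxnorm_ge0 //.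
by rewrite exprMn !sqr_mxnorm.
Qed.

Lemma mxnorm_gt0 A x : posdef A -> x != 0 -> 0 < mxnorm A x.
Proof. by move=> [_ pA] x0; rewrite sqrtr_gt0 pA. Qed.

(** The two forms [k H - A] and [k H + A] are nonnegative, so this is a
    Cauchy-Schwarz inequality for the indefinite form [A]; it is obtained by
    polarization from the vectors [x + y] and [x - y]. *)
Lemma dominated_bform A H k x y : A^T = A -> posdef H -> 0 <= k ->
  (forall z, `|bform A z z| <= k * bform H z z) ->
  bform A x y <= k * (mxnorm H x * mxnorm H y).
Proof.
move=> sA pH k0 hA; have qH := posdef_possemidef pH; have [sH _] := pH.
have polar (u v : 'cV[R]_d) :
    bform A u v <= k / 2 * (mxnorm H u ^+ 2 + mxnorm H v ^+ 2).
  have := hA (u + v); have := hA (u - v).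
  rewrite !ler_norml => /andP[+ _] /andP[_ +].
  rewrite !(bformDl, bformDr, bformNl, bformNr) (bformC v u sA) (bformC v u sH).
  rewrite !sqr_mxnorm //; nra.
have [->|x0] := eqVneq x 0; first by rewrite bform0l mxnorm0 mul0r mulr0.
have [->|y0] := eqVneq y 0.
  by rewrite -(scale0r 0) bformZr mul0r mxnormZ normr0 !(mul0r, mulr0).
have nx := mxnorm_gt0 pH x0; have ny := mxnorm_gt0 pH y0.
have := polar ((mxnorm H x)^-1 *: x) ((mxnorm H y)^-1 *: y).
rewrite bformZl bformZr !mxnormZ !ger0_norm ?invr_ge0 ?mxnorm_ge0 //.
rewrite !mulVf ?gt_eqF // expr1n.
rewrite mulrA -invfM ler_pdivrMl ?mulr_gt0 //.
by move/le_trans; apply; rewrite le_eqVlt; apply/orP; left; apply/eqP; field.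
Qed.

Lemma possemidef_unit_posdef A : possemidef A -> A \in unitmx -> posdef A.
Proof.
move=> pA uA; have [sA nA] := pA; split=> // x x0.
have := nA x; rewrite -/(bform _ _ _) le_eqVlt => /orP[/eqP xx|//].
case/eqP: x0; rewrite -[x](mulKmx uA); apply/eqP.
suff -> : A *m x = 0 by rewrite mulmx0.
apply/colP => i; rewrite [RHS]mxE; apply/eqP; rewrite -normr_le0.
have := cauchy_schwarz (delta_mx i 0) x pA.
rewrite /mxnorm -!/(bform _ _ _) -xx sqrtr0 mulr0.
by rewrite /bform -mulmxA trmx_delta -rowE [X in `|X|]mxE.
Qed.

Lemma posdef_unit A : posdef A -> A \in unitmx.
Proof.
move=> [sA pA]; rewrite -row_free_unit -kermx_eq0; apply/eqP/row_matrixP => i.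
rewrite row0; set v := row i (kermx A).
have vA : v *m A = 0 by rewrite -row_mul mulmx_ker row0.
apply/eqP/negPn/negP => v0.
have := pA v^T; rewrite /bform trmxK vA mul0mx mxE ltxx => h.
by have := h _; rewrite -trmx0 (inj_eq trmx_inj) => /(_ v0).
Qed.

Lemma mxnorm_inv A g : posdef A ->
  mxnorm A (invmx A *m g) = mxnorm (invmx A) g.
Proof.
move=> pA; have [sA _] := pA; have uA := posdef_unit pA.
rewrite /mxnorm trmx_mul trmx_inv sA -!mulmxA (mulmxA A) mulmxV //.
by rewrite mul1mx.
Qed.

Lemma dual_cauchy_schwarz A g z : posdef A ->
  dot g z <= mxnorm (invmx A) g * mxnorm A z.
Proof.
move=> pA; have [sA _] := pA; have uA := posdef_unit pA.
rewrite -mxnorm_inv //.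
have -> : dot g z = bform A (invmx A *m g) z.
  by rewrite /dot /bform trmx_mul trmx_inv sA -(mulmxA _ (invmx A)) mulVmx // mulmx1.
exact: le_trans (ler_norm _) (cauchy_schwarz _ _ (posdef_possemidef pA)).
Qed.

Lemma dual_mxnorm_le A B c g : posdef A -> posdef B -> 0 <= c ->
  (forall x, mxnorm A x <= c * mxnorm B x) ->
  mxnorm (invmx B) g <= c * mxnorm (invmx A) g.
Proof.
move=> pA pB c0 h; have uB := posdef_unit pB; have [sB _] := pB.
have [g0|g0] := eqVneq (mxnorm (invmx B) g) 0.
  by rewrite g0 mulr_ge0 ?mxnorm_ge0.
have {}g0 : 0 < mxnorm (invmx B) g by rewrite lt_neqAle eq_sym g0 mxnorm_ge0.
rewrite -(ler_pM2r g0) -expr2 -mxnorm_inv // sqr_mxnorm; last first.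
  exact: posdef_possemidef.
have -> : bform B (invmx B *m g) (invmx B *m g) = dot g (invmx B *m g).
  by rewrite -dot_mulmx mulmxA mulmxV // mul1mx dotC.
apply: le_trans (dual_cauchy_schwarz _ _ pA) _.
by rewrite mulrAC mulrC ler_wpM2r ?mxnorm_ge0 // h.
Qed.

End LinearAlgebra.

(** * Directional derivatives and Schwarz's theorem *)

Section LineDerivatives.
Context {R : realType} {V : normedModType R}.
Implicit Types (f : V -> R) (x u v : V).

Lemma is_derive_lineP f x v (t df : R) :
  is_derive (x + t *: v) v f df <-> is_derive t 1 (fun s : R => f (x + s *: v)) df.
Proof.
have e : (fun h : R => h^-1 *: (((fun s : R => f (x + s *: v)) \o shift t) (h *: 1)
    - f (x + t *: v))) =
  (fun h : R => h^-1 *: ((f \o shift (x + t *: v)) (h *: v) - f (x + t *: v))).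
  apply/funext => h /=; rewrite [_%:A]mulr1 scalerDl; congr (_ *: (f _ - _)).
  by rewrite addrCA.
split=> -[cf vf]; split.
- by rewrite /derivable e; exact: cf.
- by rewrite /derive e; exact: vf.
- by rewrite /derivable -e; exact: cf.
- by rewrite /derive -e; exact: vf.
Qed.

Lemma line_MVT f (f' : V -> R) x v (h : R) :
  (forall s : R, `|s| <= `|h| -> is_derive (x + s *: v) v f (f' (x + s *: v))) ->
  exists2 s : R, `|s| <= `|h| & f (x + h *: v) - f x = h * f' (x + s *: v).
Proof.
move=> df; pose F (s : R) := f (x + s *: v); pose F' (s : R) := f' (x + s *: v).
have dF (s : R) : `|s| <= `|h| -> is_derive s 1 F (F' s) by move=> /df/is_derive_lineP.
have cF (s : R) : `|s| <= `|h| -> {for s, continuous F}.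
  move=> /dF [dFs _]; exact/differentiable_continuous/derivable1_diffP.
have F0 : F 0 = f x by rewrite /F scale0r addr0.
rewrite -F0 -/(F h) -/F'.
have [h0|h0] := leP 0 h.
- have [||s sh e] := @MVT_segment _ F F' 0 h h0.
  + move=> s; rewrite in_itv /= => /andP[s0 sh]; apply: dF.
    by rewrite !ger0_norm // ltW.
  + apply: continuous_in_subspaceT => s; rewrite inE /= in_itv /= => /andP[s0 sh].
    by apply: cF; rewrite !ger0_norm.
  exists s; last by rewrite e subr0 mulrC.
  by move: sh; rewrite in_itv /= => /andP[s0 sh]; rewrite !ger0_norm.
- have [||s sh e] := @MVT_segment _ F F' h 0 (ltW h0).
  + move=> s; rewrite in_itv /= => /andP[s0 sh]; apply: dF.
    by rewrite !ler0_norm ?lerN2 // ltW.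
  + apply: continuous_in_subspaceT => s; rewrite inE /= in_itv /= => /andP[s0 sh].
    by apply: cF; rewrite !ler0_norm ?lerN2 // ltW.
  exists s; last by rewrite -opprB e sub0r mulrN opprK mulrC.
  move: sh; rewrite in_itv /= => /andP[s0 sh].
  by rewrite !ler0_norm ?lerN2 // ltW.
Qed.

Definition C1_along (U : set V) f v (f' : V -> R) : Prop :=
  (forall x, U x -> is_derive x v f (f' x)) /\
  (forall x, U x -> {for x, continuous f'}).

Lemma continuous_ball (U : set V) (g : V -> R) x (e : R) : open U -> U x ->
  {for x, continuous g} -> 0 < e ->
  exists2 r : R, 0 < r & forall y, `|y| < r -> U (x + y) /\ `|g (x + y) - g x| < e.
Proof.
move=> oU Ux cg e0.
have : \forall y \near x, U y /\ `|g y - g x| < e.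
  near=> y; split; first by near: y; exact: open_nbhs_nbhs.
  by rewrite distrC; near: y; move: e e0; apply/cvgrPdist_lt.
move=> /nbhs_ballP[r /= r0 h]; exists r => // y yr; apply: h.
by rewrite -ball_normE /= opprD addNKr normrN.
Unshelve. all: by end_near. Qed.

(** Moving first along [u] and then along [v], each move is evaluated by the mean
    value theorem and continuity lets the intermediate points tend to [x]. By
    linearity over a basis this turns continuous partial derivatives into
    directional ones, without passing through total differentiability. *)
Lemma C1_along_addv (U : set V) f u v fu fv : open U ->
  C1_along U f u fu -> C1_along U f v fv ->
  C1_along U f (u + v) (fun x => fu x + fv x).
Proof.
move=> oU [du cu] [dv cv]; split; last first.
  by move=> x Ux; apply: continuousD; [exact: cu|exact: cv].
move=> x Ux.
suff h : (fun h : R => h^-1 *: ((f \o shift x) (h *: (u + v)) - f x)) @ 0^'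
    --> fu x + fv x.
  split; first by apply/cvg_ex; exists (fu x + fv x).
  by apply/cvg_lim.
apply/cvgrPdist_lt => e e0; have e2 : 0 < e / 2 by rewrite divr_gt0.
have [ru ru0 hu] := continuous_ball oU Ux (cu x Ux) e2.
have [rv rv0 hv] := continuous_ball oU Ux (cv x Ux) e2.
pose r := Num.min ru rv / (1 + `|u| + `|v|).
have n0 : 0 < 1 + `|u| + `|v| by rewrite -addrA ltr_pwDl ?addr_ge0.
have r0 : 0 < r by rewrite divr_gt0 // lt_min ru0.
exists r => //= h; rewrite /= sub0r normrN => hr h0.
have small (s t : R) : `|s| <= `|h| -> `|t| <= `|h| ->
    `|s *: u + t *: v| < Num.min ru rv.
  move=> sh th; apply: le_lt_trans (ler_normD _ _) _; rewrite !normrZ.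
  apply: (@le_lt_trans _ _ (`|h| * (1 + `|u| + `|v|))); last by rewrite -ltr_pdivlMr.
  rewrite -addrA mulrDr mulr1 -[X in X <= _]add0r lerD // mulrDr.
  by rewrite lerD // ler_wpM2r.
have [|s sh es] := @line_MVT f fu x u h.
  move=> s sh; apply: du; apply: (hu (s *: u) _).1.
  have := small s 0 sh; rewrite normr0 scale0r addr0 lt_min => /(_ (normr_ge0 _)).
  by case/andP.
have [|t th et] := @line_MVT f fv (x + h *: u) v h.
  move=> t th; apply: dv; rewrite -addrA; apply: (hu _ _).1.
  by have := small h t (lexx _) th; rewrite lt_min => /andP[].
have -> : (f \o shift x) (h *: (u + v)) - f x =
    h * fv (x + h *: u + t *: v) + h * fu (x + s *: u).
  by rewrite -es -et addrA subrK; congr (f _ - _); rewrite /= scalerDr addrC addrA.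
rewrite -mulrDr /GRing.scale /= mulKf //.
rewrite distrC (_ : _ - _ = (fu (x + s *: u) - fu x) +
   (fv (x + h *: u + t *: v) - fv x)); last by ring.
apply: le_lt_trans (ler_normD _ _) _; rewrite [e]splitr ltrD //.
  have := small s 0 sh; rewrite normr0 scale0r addr0 lt_min => /(_ (normr_ge0 _)).
  by case/andP => /hu[].
have := small h t (lexx _) th; rewrite lt_min => /andP[_ /hv[_]].
by rewrite addrA.
Qed.

Lemma C1_along_scalev (U : set V) f v fv (c : R) : C1_along U f v fv ->
  C1_along U f (c *: v) (fun x => c * fv x).
Proof.
move=> [dv cv]; split=> x Ux; last first.
  by apply: continuousM; [exact: cst_continuous|exact: cv].
have := dv x Ux; rewrite -{1}[x]addr0 -[X in x + X](scale0r v).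
move/is_derive_lineP => d0.
rewrite -[x in is_derive x](addr0 x) -[X in x + X](scale0r (c *: v)).
apply/is_derive_lineP.
have -> : (fun s : R => f (x + s *: (c *: v))) =
    (fun s : R => f (x + s *: v)) \o (fun s : R => s * c).
  by apply/funext => s /=; rewrite scalerA.
rewrite mulrC; apply: is_derive1_comp; first by rewrite mul0r.
apply: is_derive_eq.
by rewrite scaler0 add0r [LHS]mulr1.
Qed.

Lemma C1_along_zerov (U : set V) f : C1_along U f 0 (fun=> 0).
Proof. by split=> x Ux; [exact: is_derive0|exact: cst_continuous]. Qed.

Lemma is_derive_translate f x v w (df : R) :
  is_derive (x + w) v f df -> is_derive x v (fun y => f (y + w)) df.
Proof.
move=> d; rewrite -[x]addr0 -[X in x + X](scale0r v); apply/is_derive_lineP.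
have -> : (fun s : R => f (x + s *: v + w)) = (fun s : R => f (x + w + s *: v)).
  by apply/funext => s; rewrite addrAC.
by apply/is_derive_lineP; rewrite scale0r addr0.
Qed.

(** Applying the mean value theorem to [y |-> f (y + h v) - f y] in the
    direction [u], and then to [fu] in the direction [v]. *)
Lemma second_difference (U : set V) f fu fuv x u v (h : R) :
  (forall y, U y -> is_derive y u f (fu y)) ->
  (forall y, U y -> is_derive y v fu (fuv y)) ->
  (forall s t : R, `|s| <= `|h| -> `|t| <= `|h| -> U (x + s *: u + t *: v)) ->
  exists s t : R, [/\ `|s| <= `|h|, `|t| <= `|h| &
    f (x + h *: u + h *: v) - f (x + h *: u) - (f (x + h *: v) - f x) =
      h * (h * fuv (x + s *: u + t *: v))].
Proof.
move=> du duv Uh.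
have U0 (s : R) : `|s| <= `|h| -> U (x + s *: u).
  by move=> sh; have := Uh s 0 sh; rewrite normr0 scale0r addr0 => /(_ (normr_ge0 _)).
have [|s sh es] := @line_MVT (fun y => f (y + h *: v) - f y)
    (fun y => fu (y + h *: v) - fu y) x u h.
  move=> s sh; apply: is_deriveB; last exact/du/U0.
  by apply/is_derive_translate/du/Uh.
have [|t th et] := @line_MVT fu fuv (x + s *: u) v h.
  by move=> t th; apply/duv/Uh.
by exists s, t; split=> //; rewrite es et.
Qed.

(** Schwarz's theorem: the second difference of [f] over a small parallelogram is
    symmetric in [u] and [v], and equals [h ^ 2] times either mixed derivative at
    some point of the parallelogram. *)
Lemma mixed_derivatives_commute (U : set V) f u v fu fv fuv fvu x : open U -> U x ->
  C1_along U f u fu -> C1_along U f v fv ->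
  C1_along U fu v fuv -> C1_along U fv u fvu -> fuv x = fvu x.
Proof.
move=> oU Ux [du _] [dv _] [duv cuv] [dvu cvu].
apply/eqP/negPn/negP; rewrite -subr_eq0 -normr_gt0 => e0.
set e := `|_| in e0; have e2 : 0 < e / 2 by rewrite divr_gt0.
have [r1 r10 h1] := continuous_ball oU Ux (cuv x Ux) e2.
have [r2 r20 h2] := continuous_ball oU Ux (cvu x Ux) e2.
have n0 : 0 < 1 + `|u| + `|v| by rewrite -addrA ltr_pwDl ?addr_ge0.
pose h := Num.min r1 r2 / 2 / (1 + `|u| + `|v|).
have r0 : 0 < Num.min r1 r2 by rewrite lt_min r10.
have h0 : 0 < h by rewrite !divr_gt0.
have small (s t : R) : `|s| <= `|h| -> `|t| <= `|h| ->
    `|s *: u + t *: v| < Num.min r1 r2.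
  move=> sh th; apply: le_lt_trans (ler_normD _ _) _; rewrite !normrZ.
  apply: (@le_lt_trans _ _ (`|h| * (1 + `|u| + `|v|))).
    rewrite -addrA mulrDr mulr1 -[X in X <= _]add0r lerD // mulrDr.
    by rewrite lerD // ler_wpM2r.
  by rewrite gtr0_norm // divfK ?gt_eqF // ltr_pdivrMr // ltr_pMr // ltr1n.
have [s [t [sh th e1]]] : exists s t : R, [/\ `|s| <= `|h|, `|t| <= `|h| &
    f (x + h *: u + h *: v) - f (x + h *: u) - (f (x + h *: v) - f x) =
      h * (h * fuv (x + s *: u + t *: v))].
  apply: second_difference du duv _ => s t sh th.
  by rewrite -addrA; have := small s t sh th; rewrite lt_min => /andP[/h1[]].
have [s' [t' [sh' th' e3]]] : exists s t : R, [/\ `|s| <= `|h|, `|t| <= `|h| &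
    f (x + h *: v + h *: u) - f (x + h *: v) - (f (x + h *: u) - f x) =
      h * (h * fvu (x + s *: v + t *: u))].
  apply: second_difference dv dvu _ => s' t' sh' th'.
  rewrite -addrA [s' *: _ + _]addrC.
  by have := small t' s' th' sh'; rewrite lt_min => /andP[/h1[]].
have : fuv (x + s *: u + t *: v) = fvu (x + s' *: v + t' *: u).
  have hn0 : h != 0 by rewrite gt_eqF.
  apply/(mulfI hn0)/(mulfI hn0); rewrite -e1 -e3 (addrAC x); ring.
have := small s t sh th; rewrite lt_min => /andP[/h1[_ +] _].
have := small t' s' th' sh'; rewrite lt_min => /andP[_ /h2[_]].
rewrite [t' *: _ + _]addrC !addrA => b2 b1 eq.
suff : e < e / 2 + e / 2 by rewrite -splitr ltxx.
rewrite {1}/e (_ : _ - _ = (fvu (x + s' *: v + t' *: u) - fvu x) -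
   (fuv (x + s *: u + t *: v) - fuv x)); last by rewrite eq; ring.
by apply: le_lt_trans (ler_normB _ _) _; rewrite ltrD.
Qed.

End LineDerivatives.

Section SmoothFunctions.
Context {R : realType} {d : nat}.
Implicit Types (f : 'cV[R]_d -> R) (U : set 'cV[R]_d) (x u v : 'cV[R]_d).

Lemma class_C_partial k U f i : class_C k.+1 U f -> class_C k U (partial i f).
Proof. by move=> [_ /(_ i)[]]. Qed.

Lemma class_C_continuous k U f x : class_C k U f -> U x -> {for x, continuous f}.
Proof. by case: k => [|k] [cf _]; exact: cf. Qed.

Lemma class_CS k U f : class_C k.+1 U f -> class_C k U f.
Proof.
elim: k f => [|k IH] f [cf df]; split=> // i.
by split; [exact: (df i).1|exact/IH/(df i).2].
Qed.

Lemma class_C_along k U f i : class_C k.+1 U f ->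
  C1_along U f (delta_mx i 0) (partial i f).
Proof.
move=> [cf /(_ i)[df cdf]]; split=> x Ux; last exact: class_C_continuous cdf Ux.
by apply: derivableP; exact: df.
Qed.

Lemma class_C1_along k U f v : open U -> class_C k.+1 U f ->
  C1_along U f v (fun x => dot v (gradient f x)).
Proof.
move=> oU Cf.
have -> : (fun x => dot v (gradient f x)) =
    (fun x => \sum_i v i 0 * partial i f x).
  by apply/funext => x; rewrite /dot mxE; apply: eq_bigr => i _; rewrite !mxE.
have -> : v = \sum_i v i 0 *: delta_mx i 0.
  rewrite {1}[v]matrix_sum_delta; apply: eq_bigr => i _.
  by rewrite big_ord_recl big_ord0 addr0.
have -> : (fun x => \sum_i (\sum_i v i 0 *: delta_mx i 0 : 'cV[R]_d) i 0 * partial i f x)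
   = (fun x => \sum_i v i 0 * partial i f x).
  apply/funext => x; apply: eq_bigr => i _; congr (_ * _).
  rewrite summxE (bigD1 i) //= big1 ?addr0; last first.
    by move=> j ji; rewrite !mxE (negPf (_ : i != j)) ?mulr0 // eq_sym.
  by rewrite !mxE !eqxx mulr1.
elim: (index_enum _) => [|i r IH].
  rewrite big_nil (_ : (fun x => _) = (fun=> 0)); first exact: C1_along_zerov.
  by apply/funext => x; rewrite big_nil.
rewrite big_cons (_ : (fun x => _) = (fun x => v i 0 * partial i f x +
  \sum_(j <- r) v j 0 * partial j f x)); last first.
  by apply/funext => x; rewrite big_cons.
apply: C1_along_addv => //.
exact/C1_along_scalev/(class_C_along _ Cf).
Qed.

Lemma partialC k U f i j x : open U -> U x -> class_C k.+2 U f ->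
  partial i (partial j f) x = partial j (partial i f) x.
Proof.
move=> oU Ux Cf.
exact: (mixed_derivatives_commute oU Ux (class_C_along j Cf) (class_C_along i Cf)
  (class_C_along i (class_C_partial j Cf)) (class_C_along j (class_C_partial i Cf))).
Qed.

End SmoothFunctions.

(** * The third derivative as a symmetric trilinear form *)

Section HigherDerivatives.
Context {R : realType} {d : nat}.
Implicit Types (f : 'cV[R]_d -> R) (U : set 'cV[R]_d) (x u v a b c : 'cV[R]_d).

Definition trilinear f x a b c : R :=
  \sum_i \sum_j \sum_k
    partial i (partial j (partial k f)) x * a i 0 * b j 0 * c k 0.

Lemma C1_along_scale U f v f' (k : R) : C1_along U f v f' ->
  C1_along U (fun x => k * f x) v (fun x => k * f' x).
Proof.
move=> [df cf]; split=> x Ux.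
  exact: (is_deriveZ k (df x Ux)).
by apply: continuousM; [exact: cst_continuous|exact: cf].
Qed.

Lemma C1_along_sum U v (I : Type) (r : seq I) (F F' : I -> 'cV[R]_d -> R) :
  (forall i, C1_along U (F i) v (F' i)) ->
  C1_along U (fun x => \sum_(i <- r) F i x) v (fun x => \sum_(i <- r) F' i x).
Proof.
move=> dF; elim: r => [|i r [dr cr]].
  have e0 (G : I -> 'cV[R]_d -> R) : (fun x => \sum_(i <- [::]) G i x) = (fun=> 0).
    by apply/funext => x; rewrite big_nil.
  rewrite !e0.
  by split=> x Ux; [exact: is_derive_cst|exact: cst_continuous].
have e1 (G : I -> 'cV[R]_d -> R) : (fun x => \sum_(j <- i :: r) G j x) =
    (fun x => G i x + \sum_(j <- r) G j x).
  by apply/funext => x; rewrite big_cons.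
rewrite !e1.
have [di ci] := dF i; split=> x Ux.
  exact: is_deriveD (di x Ux) (dr x Ux).
by apply: continuousD; [exact: ci|exact: cr].
Qed.

Lemma hessianE f x a b :
  bform (hessian f x) a b = \sum_i a i 0 * \sum_j b j 0 * partial i (partial j f) x.
Proof.
rewrite /bform mxE.
under eq_bigr => j _ do rewrite mxE big_distrl /=.
rewrite exchange_big /=; apply: eq_bigr => i _; rewrite big_distrr /=.
by apply: eq_bigr => j _; rewrite !mxE; ring.
Qed.

Lemma gradient_along U f v q : open U -> class_C 2 U f ->
  C1_along U (fun x => dot q (gradient f x)) v (fun x => bform (hessian f x) v q).
Proof.
move=> oU Cf.
have -> : (fun x => dot q (gradient f x)) = (fun x => \sum_i q i 0 * partial i f x).
  by apply/funext => x; rewrite /dot mxE; apply: eq_bigr => i _; rewrite !mxE.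
have -> : (fun x => bform (hessian f x) v q) =
    (fun x => \sum_j q j 0 * dot v (gradient (partial j f) x)).
  apply/funext => x; rewrite hessianE.
  under eq_bigr => i _ do rewrite big_distrr /=.
  rewrite exchange_big /=; apply: eq_bigr => j _.
  rewrite /dot mxE big_distrr /=; apply: eq_bigr => i _; rewrite !mxE; ring.
apply: C1_along_sum => j; apply: C1_along_scale.
exact: class_C1_along (class_C_partial _ Cf).
Qed.

Lemma hessian_along U f v a b : open U -> class_C 3 U f ->
  C1_along U (fun x => bform (hessian f x) a b) v (fun x => trilinear f x v a b).
Proof.
move=> oU Cf.
have -> : (fun x => bform (hessian f x) a b) =
    (fun x => \sum_i a i 0 * \sum_j b j 0 * partial i (partial j f) x).
  by apply/funext => x; exact: hessianE.
have -> : (fun x => trilinear f x v a b) =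
    (fun x => \sum_i a i 0 * \sum_j b j 0 *
       dot v (gradient (partial i (partial j f)) x)).
  apply/funext => x; rewrite /trilinear exchange_big /=; apply: eq_bigr => i _.
  rewrite big_distrr /= exchange_big /=; apply: eq_bigr => j _.
  rewrite /dot mxE !big_distrr /=; apply: eq_bigr => k _; rewrite !mxE; ring.
apply: C1_along_sum => i; apply: C1_along_scale.
apply: C1_along_sum => j; apply: C1_along_scale.
exact: class_C1_along (class_C_partial _ (class_C_partial _ Cf)).
Qed.

Lemma trilinear_swap12 U f x a b c : open U -> U x -> class_C 3 U f ->
  trilinear f x a b c = trilinear f x b a c.
Proof.
move=> oU Ux Cf; rewrite /trilinear exchange_big /=.
apply: eq_bigr => j _; apply: eq_bigr => i _; apply: eq_bigr => k _.
by rewrite (partialC j i oU Ux (class_C_partial k Cf)); congr (_ * _); rewrite mulrAC.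
Qed.

Lemma partialC23 U f i j k x : open U -> U x -> class_C 3 U f ->
  partial i (partial j (partial k f)) x = partial i (partial k (partial j f)) x.
Proof.
move=> oU Ux Cf; rewrite {1 4}/partial; apply: near_eq_derive.
have : \forall y \near x, U y by exact: open_nbhs_nbhs.
have C2 : class_C 2 U f by exact: class_CS Cf.
by apply: filterS => y Uy; exact: (@partialC _ _ 0 _ _ j k _ oU Uy C2).
Qed.

Lemma trilinear_swap23 U f x a b c : open U -> U x -> class_C 3 U f ->
  trilinear f x a b c = trilinear f x a c b.
Proof.
move=> oU Ux Cf; rewrite /trilinear; apply: eq_bigr => i _.
rewrite exchange_big /=; apply: eq_bigr => k _; apply: eq_bigr => j _.
by rewrite [LHS]mulrAC [in LHS](partialC23 i j k oU Ux Cf).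
Qed.

Lemma trilinearD f x a a' b c :
  trilinear f x (a + a') b c = trilinear f x a b c + trilinear f x a' b c.
Proof.
rewrite /trilinear -big_split /=; apply: eq_bigr => i _.
rewrite -big_split /=; apply: eq_bigr => j _.
rewrite -big_split /=; apply: eq_bigr => k _.
by rewrite mxE mulrDr !mulrDl.
Qed.

Lemma trilinearZ f x (k : R) a b c :
  trilinear f x (k *: a) b c = k * trilinear f x a b c.
Proof.
rewrite /trilinear !big_distrr /=; apply: eq_bigr => i _.
rewrite !big_distrr /=; apply: eq_bigr => j _.
rewrite !big_distrr /=; apply: eq_bigr => l _; rewrite mxE; ring.
Qed.

(** Polarization: [T (h + v)^3 - T (h - v)^3 = 6 T v h h + 2 T v v v], so that
    for unit vectors [h] and [v] the parallelogram identity gives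
    [6 `|T v h h| <= 2 M (8 + 2)]. *)
Lemma trilinear_le U f x (M : R) H v h : open U -> U x -> class_C 3 U f ->
  0 <= M -> posdef H ->
  (forall u, `|trilinear f x u u u| <= 2 * M * mxnorm H u ^+ 3) ->
  `|trilinear f x v h h| <= 10 / 3 * M * mxnorm H v * mxnorm H h ^+ 2.
Proof.
move=> oU Ux Cf M0 pH hT; have qH := posdef_possemidef pH; have [sH _] := pH.
have s12 := fun a b c => trilinear_swap12 a b c oU Ux Cf.
have s23 := fun a b c => trilinear_swap23 a b c oU Ux Cf.
set T := trilinear f x in hT s12 s23 *.
have TD1 a a' b c : T (a + a') b c = T a b c + T a' b c by exact: trilinearD.
have TZ1 k a b c : T (k *: a) b c = k * T a b c by exact: trilinearZ.
have TD2 a b b' c : T a (b + b') c = T a b c + T a b' c.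
  by rewrite s12 TD1 !(s12 a).
have TZ2 k a b c : T a (k *: b) c = k * T a b c by rewrite s12 TZ1 (s12 a).
have TD3 a b c c' : T a b (c + c') = T a b c + T a b c'.
  by rewrite s23 TD2 !(s23 a b).
have TZ3 k a b c : T a b (k *: c) = k * T a b c by rewrite s23 TZ2 (s23 a b).
have unit (u w : 'cV[R]_d) : mxnorm H u = 1 -> mxnorm H w = 1 ->
    `|T u w w| <= 10 / 3 * M.
  move=> nu nw.
  have e : T (w + u) (w + u) (w + u) - T (w + -1 *: u) (w + -1 *: u) (w + -1 *: u)
      = 6 * T u w w + 2 * T u u u.
    rewrite !(TD1, TD2, TD3, TZ1, TZ2, TZ3) (s12 w u w) (s23 w w u) (s12 w u w).
    rewrite (s12 w u u) (s23 u w u); ring.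
  have par : mxnorm H (w + u) ^+ 2 + mxnorm H (w + -1 *: u) ^+ 2 = 4.
    have := sqr_mxnorm u qH; have := sqr_mxnorm w qH; rewrite nu nw.
    rewrite !sqr_mxnorm // !(bformDl, bformDr, bformZl, bformZr) (bformC u w sH); lra.
  have p0 := mxnorm_ge0 H (w + u); have m0 := mxnorm_ge0 H (w + -1 *: u).
  have cub : mxnorm H (w + u) ^+ 3 + mxnorm H (w + -1 *: u) ^+ 3 <= 8.
    move: p0 m0 par; set p := mxnorm H _; set m := mxnorm H _ => p0 m0 par.
    have p2 : p <= 2 by nra.
    have m2 : m <= 2 by nra.
    by nra.
  have := hT (w + u); have := hT (w + -1 *: u); have := hT u; rewrite nu expr1n.
  move: e cub; set p := T (w + u) _ _; set m := T (w + -1 *: u) _ _.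
  move=> e cub; rewrite !ler_norml => /andP[? ?] /andP[? ?] /andP[? ?].
  apply/andP; split; nra.
have [->|v0] := eqVneq v 0.
  by rewrite -(scale0r 0) TZ1 mul0r normr0 !mulr_ge0 ?mxnorm_ge0 // ?sqr_ge0; lra.
have [->|h0] := eqVneq h 0.
  by rewrite -(scale0r 0) TZ2 mul0r normr0 !mulr_ge0 ?mxnorm_ge0 // ?sqr_ge0; lra.
have nv := mxnorm_gt0 pH v0; have nh := mxnorm_gt0 pH h0.
have nrm1 (u : 'cV[R]_d) : 0 < mxnorm H u -> mxnorm H ((mxnorm H u)^-1 *: u) = 1.
  by move=> u0; rewrite mxnormZ ger0_norm ?invr_ge0 ?ltW // mulVf ?gt_eqF.
have := unit _ _ (nrm1 v nv) (nrm1 h nh); rewrite TZ1 TZ2 TZ3.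
move: nv nh; set a := mxnorm H v; set b := mxnorm H h => a0 b0.
rewrite (_ : _ * _ = T v h h / (a * b ^+ 2)); last first.
  by field; rewrite !gt_eqF.
rewrite normrM normfV (@gtr0_norm _ (a * _)) ?mulr_gt0 ?exprn_gt0 //.
by rewrite ler_pdivrMr ?mulr_gt0 ?exprn_gt0 // !mulrA.
Qed.

End HigherDerivatives.

(** * Differential inequalities on the line *)

Section OneDimensional.
Context {R : realType}.

Lemma MVT01 (F F' : R -> R) (t : R) : 0 <= t ->
  (forall s, 0 <= s <= t -> is_derive s 1 F (F' s)) ->
  exists2 s, 0 <= s <= t & F t - F 0 = t * F' s.
Proof.
move=> t0 dF.
have [s s0t|s|s s0t e] := @MVT_segment _ F F' 0 t t0.
- by apply: dF; move: s0t; rewrite in_itv /= => /andP[/ltW-> /ltW->].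
- apply: continuous_in_subspaceT => u; rewrite inE /= in_itv /= => /dF[du _].
  exact/differentiable_continuous/derivable1_diffP.
- by exists s; [move: s0t; rewrite in_itv|rewrite e subr0 mulrC].
Qed.

Lemma gronwall01 (F F' : R -> R) (c : R) :
  (forall t : R, 0 <= t <= 1 -> is_derive t 1 F (F' t) /\ F' t <= c * F t) ->
  F 1 <= expR c * F 0.
Proof.
move=> dF.
have dG (t : R) : 0 <= t <= 1 ->
    is_derive t 1 (fun s => F s * expR (- c * s)) (expR (- c * t) * (F' t - c * F t)).
  move=> /dF[dFt _].
  have de : is_derive t 1 (fun s => expR (- c * s)) (expR (- c * t) * - c).
    apply: (@is_derive1_comp _ expR (fun s => - c * s)).
    by apply: is_derive_eq; rewrite [LHS]mulr1.
  have dM := @is_deriveM _ _ F (fun s => expR (- c * s)) t 1 _ _ dFt de.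
  apply: (is_derive_eq dM).
  by rewrite /GRing.scale /=; ring.
have [s s01 e] := MVT01 ler01 dG.
have : F 1 * expR (- c * 1) <= F 0.
  rewrite mulr0 expR0 mulr1 in e; rewrite -subr_le0 e mul1r.
  by rewrite mulr_ge0_le0 ?expR_ge0 // subr_le0; exact: (dF s s01).2.
by rewrite mulr1 expRN ler_pdivrMr ?expR_gt0 // mulrC.
Qed.

(** The bound on [F'] says that [1 / sqrt F] has derivative at least [- M]. *)
Lemma inv_sqrt_growth (F F' : R -> R) (M t : R) : 0 <= t ->
  (forall s, 0 <= s <= t -> [/\ 0 < F s, is_derive s 1 F (F' s) &
     `|F' s| <= 2 * M * Num.sqrt (F s) ^+ 3]) ->
  M * Num.sqrt (F 0) * t < 1 ->
  Num.sqrt (F t) <= Num.sqrt (F 0) / (1 - M * Num.sqrt (F 0) * t).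
Proof.
move=> t0 dF small; pose n s := Num.sqrt (F s).
have n0 (s : R) : 0 <= s <= t -> 0 < n s by move=> /dF[Fs _ _]; rewrite sqrtr_gt0.
have dn (s : R) : 0 <= s <= t ->
    is_derive s 1 (fun s => (n s)^-1) (- (n s) ^- 2 * ((2 * n s)^-1 * F' s)).
  move=> st; have [Fs dFs _] := dF s st.
  apply: is_deriveV; first by rewrite gt_eqF ?n0.
  by apply: (@is_derive1_comp _ Num.sqrt F); exact: is_derive1_sqrt.
have [s st e] := MVT01 t0 dn; have [_ _ Fs] := dF s st.
have ns := n0 s st; rewrite -/(n s) in Fs.
have : - M <= - (n s) ^- 2 * ((2 * n s)^-1 * F' s).
  rewrite (_ : - _ * _ = - (F' s / (2 * n s ^+ 3))); last by field; rewrite gt_eqF.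
  rewrite lerN2 ler_pdivrMr ?mulr_gt0 ?exprn_gt0 //.
  by apply: le_trans (ler_norm _) (le_trans Fs _); rewrite [leRHS]mulrA [M * 2]mulrC.
move=> /(ler_wpM2l t0); rewrite -e => h.
have [n00 nt] : 0 < n 0 /\ 0 < n t by split; apply: n0; rewrite lexx t0.
have {}h : (1 - M * n 0 * t) / n 0 <= (n t)^-1.
  rewrite mulrBl mul1r (mulrAC M) mulfK ?gt_eqF //; lra.
rewrite -/(n 0) -/(n t) -[X in X <= _]invrK -[X in _ <= X]invrK.
by rewrite lef_pV2 ?posrE ?invr_gt0 ?divr_gt0 // ?subr_gt0 // invf_div.
Qed.

End OneDimensional.

(** * Continuity, strong monotonicity and one-sided minima *)

Section Continuity.
Context {R : realType} {d : nat}.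
Implicit Types (x s : 'cV[R]_d) (A : 'M[R]_d).

Lemma sum_continuous (T : topologicalType) (I : Type) (r : seq I) (F : I -> T -> R) :
  (forall i, continuous (F i)) -> continuous (fun t => \sum_(i <- r) F i t).
Proof. by move=> cF; apply: continuous_big => //; exact: add_continuous. Qed.

Lemma dot_continuous s : continuous (dot s).
Proof.
have -> : dot s = (fun y => \sum_i s i 0 * y i 0).
  by apply/funext => y; rewrite /dot mxE; apply: eq_bigr => i _; rewrite mxE.
apply: sum_continuous => i y.
by apply: continuousM; [exact: cst_continuous|exact: coord_continuous].
Qed.

Lemma bform_continuous A : continuous (fun y => bform A y y).
Proof.
have -> : (fun y => bform A y y) = (fun y => \sum_j dot (col j A) y * y j 0).
  apply/funext => y; rewrite /bform mxE; apply: eq_bigr => j _; congr (_ * _).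
  by rewrite /dot !mxE; apply: eq_bigr => i _; rewrite !mxE mulrC.
apply: sum_continuous => j y.
by apply: continuousM; [exact: dot_continuous|exact: coord_continuous].
Qed.

End Continuity.

Section StrongMonotonicity.
Context {R : realType} {d : nat}.

Lemma strong_monotonicity_bound (A : 'M[R]_d) (z p p' : 'cV[R]_d) (delta : R) :
  posdef A -> mxnorm (invmx A) p <= delta -> 0 <= dot (- z) p' ->
  bform A z z <= 6 / 5 * dot z (p' - p) -> mxnorm A z <= 6 / 5 * delta.
Proof.
move=> pA pd; rewrite dotNl oppr_ge0 => vi lb.
have := dual_cauchy_schwarz (- p) z pA.
rewrite mxnormN dotNl dotC => cs.
have n0 := mxnorm_ge0 A z.
have {}cs := le_trans cs (ler_wpM2r n0 pd).
have : mxnorm A z ^+ 2 <= 6 / 5 * delta * mxnorm A z.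
  by rewrite (sqr_mxnorm _ (posdef_possemidef pA)); move: lb; rewrite dotDr dotNr; lra.
move: n0; rewrite le_eqVlt => /orP[/eqP <- _|n0].
  have := mxnorm_ge0 (invmx A) p; lra.
by rewrite expr2 ler_pM2r.
Qed.

End StrongMonotonicity.

Section OneSidedMinimum.
Context {R : realType}.

Lemma derive_ge0_of_right_min (f : R -> R) (df e : R) : is_derive (0 : R) 1 f df -> 0 < e ->
  (forall h, 0 < h < e -> f 0 <= f h) -> 0 <= df.
Proof.
move=> [cf vf] e0 fmin; rewrite leNgt; apply/negP => df0.
have : (fun h : R => h^-1 *: ((f \o shift 0) (h *: 1) - f 0)) @ 0^' --> df.
  by rewrite -vf; exact: cf.
have ndf : 0 < - df by rewrite oppr_gt0.
move=> /cvgrPdist_lt/(_ _ ndf)[r /= r0 /(_ (Num.min r e / 2))].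
have m0 : 0 < Num.min r e by rewrite lt_min r0.
have m2 : Num.min r e / 2 < Num.min r e by rewrite ltr_pdivrMr // ltr_pMr // ltr1n.
have h0 : 0 < Num.min r e / 2 by rewrite divr_gt0.
have : Num.min r e <= r /\ Num.min r e <= e by rewrite !ge_min !lexx orbT.
move: m2 h0; set h := _ / 2 => m2 h0 [mr me].
rewrite /= sub0r normrN gtr0_norm // => /(_ (lt_le_trans m2 mr)).
rewrite gt_eqF // => /(_ isT); rewrite addr0 /GRing.scale /= mulr1.
have := fmin h; rewrite h0 (lt_le_trans m2 me) => /(_ isT) fh.
have : 0 <= h^-1 * (f h - f 0) by apply: mulr_ge0; rewrite ?invr_ge0 ?subr_ge0 // ltW.
by rewrite ltr_norml => q0 /andP[+ _]; lra.
Qed.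

End OneSidedMinimum.

(** * Estimates of the Hessian *)

Section HessianEstimates.
Context {R : realType} {d : nat}.
Implicit Types (A D H : 'M[R]_d) (x y z g : 'cV[R]_d).

Lemma loewner_leP A B : loewner_le A B -> forall x, bform A x x <= bform B x x.
Proof.
by move=> [_ h] x; have := h x; rewrite -/(bform _ _ _) bformDm bformNm subr_ge0.
Qed.

(** Both sandwich bounds are about symmetric nonnegative differences; adding
    them shows that [D] itself is symmetric and nonnegative. As [H] is
    invertible it is then definite, and so is [D]. *)
Lemma sandwich_posdef D H Hinv (a : R) : 0 < a < 1 -> H *m Hinv = 1%:M ->
  loewner_le ((1 - a) *: D) H -> loewner_le H ((1 + a) *: D) ->
  [/\ posdef D, posdef H & Hinv = invmx H].
Proof.
move=> /andP[a0 a1] HH lo hi.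
have uH : H \in unitmx by have [] := mulmx1_unit HH.
have a2 : 2 * a != 0 by rewrite mulf_neq0 // ?gt_eqF // pnatr_eq0.
have sD : D^T = D.
  have [s1 _] := lo; have [s2 _] := hi.
  have e : (1 + a) *: D - H + (H - (1 - a) *: D) = (2 * a) *: D.
    by rewrite addrA subrK -scalerBl; congr (_ *: _); ring.
  have := congr1 trmx e; rewrite linearD /= s1 s2 e linearZ /=.
  by move/(scalerI a2).
have sH : H^T = H.
  have [s1 _] := lo; move: s1; rewrite linearB /= linearZ /= sD.
  by move/addIr.
have nD x : 0 <= bform D x x.
  have := loewner_leP lo x; have := loewner_leP hi x; rewrite !bformZm; nra.
have nH x : 0 <= bform H x x.
  have := loewner_leP lo x; have := nD x; rewrite !bformZm; nra.
have pH : posdef H by apply: possemidef_unit_posdef.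
split=> //; last by rewrite -[RHS]mulmx1 -HH mulmxA mulVmx // mul1mx.
split=> // x x0; have [_ /(_ x x0)] := pH.
have := loewner_leP hi x; rewrite bformZm; nra.
Qed.

(** A tenth of a percent is the accuracy prescribed for the Hessian oracle. *)
Definition approximates H D : Prop := posdef H /\
  forall x, 999 / 1000 * bform D x x <= bform H x x <= 1001 / 1000 * bform D x x.

(** [z - H^-1 G] is [H^-1 (H - A) z] when [G = A z]; it is enough to know [G] in
    the direction of this vector, which is how the mean value theorem gives it. *)
Lemma newton_contraction A H (k : R) z G : A^T = A -> posdef H -> 0 <= k ->
  (forall x, `|bform (H - A) x x| <= k * bform H x x) ->
  dot (z - invmx H *m G) G = bform A z (z - invmx H *m G) ->
  mxnorm H (z - invmx H *m G) <= k * mxnorm H z.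
Proof.
move=> sA pH k0 hA; set y := z - _ => e; have [sH _] := pH.
have uH := posdef_unit pH.
have [y0|y0] := eqVneq (mxnorm H y) 0.
  by rewrite y0 mulr_ge0 ?mxnorm_ge0.
have {}y0 : 0 < mxnorm H y by rewrite lt_neqAle eq_sym y0 mxnorm_ge0.
rewrite -(ler_pM2r y0) -expr2 (sqr_mxnorm _ (posdef_possemidef pH)).
have -> : bform H y y = bform (H - A) y z.
  rewrite bformDm bformNm (bformC y z sA) -e {2}/y bformDr bformNr.
  by rewrite -[bform H y (invmx H *m G)]dot_mulmx mulmxA mulmxV // mul1mx.
rewrite mulrAC -mulrA; apply: dominated_bform => //.
by rewrite linearB /= sA sH.
Qed.

Lemma hessian_sandwich_trans (h a c : R) :
  999 / 1000 * a <= h <= 1001 / 1000 * a -> c <= 6 / 5 * a -> a <= 6 / 5 * c ->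
  0 <= a -> 0 <= c -> 4 / 5 * h <= c <= 121 / 100 * h /\ h <= 121 / 100 * c.
Proof. by move=> /andP[h1 h2] h3 h4 h5 h6; split; [apply/andP; split|]; lra. Qed.

End HessianEstimates.

(** * The geometry of a self-concordant barrier *)

Section SelfConcordant.
Context {R : realType} {d : nat} (K : set 'cV[R]_d) (Phi : 'cV[R]_d -> R) (M : R).
Hypotheses (M0 : 0 < M) (cK : compact K) (sc : self_concordant K Phi M).
Hypothesis posdefH : forall x, K° x -> posdef (hessian Phi x).
Implicit Types (x y v h q : 'cV[R]_d).

Local Notation D := (hessian Phi).
Local Notation N x v := (mxnorm (hessian Phi x) v).

Let oU : open K° := @open_interior _ K.
Let C3 : class_C 3 K° Phi. Proof. by case: sc. Qed.
Let C2 : class_C 2 K° Phi. Proof. exact: class_CS C3. Qed.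

Let posH x : K° x -> possemidef (D x).
Proof. by move=> /posdefH/posdef_possemidef. Qed.

Lemma self_concordant_third x v h : K° x ->
  `|trilinear Phi x v h h| <= 10 / 3 * M * N x v * N x h ^+ 2.
Proof.
move=> Kx; apply: (trilinear_le v h oU Kx C3 (ltW M0) (posdefH Kx)) => u.
by case: sc => _ _ _ /(_ x u Kx).
Qed.

Lemma is_derive_Phi_line x v (t : R) : K° (x + t *: v) ->
  is_derive t 1 (fun s => Phi (x + s *: v)) (dot v (gradient Phi (x + t *: v))).
Proof.
move=> Ut; apply/(is_derive_lineP Phi).
exact: (@class_C1_along _ _ 2 _ _ v oU C3).1 _ Ut.
Qed.

Lemma is_derive_gradient_line x v q (t : R) : K° (x + t *: v) ->
  is_derive t 1 (fun s => dot q (gradient Phi (x + s *: v)))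
    (bform (D (x + t *: v)) v q).
Proof.
move=> Ut; apply/(is_derive_lineP (fun y => dot q (gradient Phi y))).
exact: (gradient_along v q oU C2).1 _ Ut.
Qed.

Lemma is_derive_hessian_line x v h (t : R) : K° (x + t *: v) ->
  is_derive t 1 (fun s => bform (D (x + s *: v)) h h)
    (trilinear Phi (x + t *: v) v h h).
Proof.
move=> Ut; apply/(is_derive_lineP (fun y => bform (D y) h h)).
exact: (hessian_along v h h oU C3).1 _ Ut.
Qed.

Lemma local_norm_growth x v (t : R) : 0 <= t -> M * N x v * t < 1 ->
  (forall s, 0 <= s <= t -> K° (x + s *: v)) ->
  N (x + t *: v) v <= N x v / (1 - M * N x v * t).
Proof.
move=> t0 small Us.
have [v0|v0] := eqVneq v 0.
  have e y : N y v = 0 by rewrite v0 mxnorm0.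
  apply: (@le_trans _ _ 0); first by rewrite e.
  by rewrite mulr_ge0 ?mxnorm_ge0 // invr_ge0 subr_ge0 ltW.
have := @inv_sqrt_growth _ (fun s => bform (D (x + s *: v)) v v)
  (fun s => trilinear Phi (x + s *: v) v v v) M t t0.
rewrite scale0r addr0; apply=> // s st; split.
- by have [_ ->] := posdefH (Us s st).
- exact/is_derive_hessian_line/Us.
- by case: sc => _ _ _ /(_ _ v (Us s st)).
Qed.

(** Along a segment on which the local norm of [v] stays bounded, [Phi] stays
    bounded too, so the segment cannot leave the interior: it would do so at
    a boundary point, where [Phi] blows up. *)
Lemma barrier_endpoint x v (t C : R) : 0 < t -> t <= 1 ->
  (forall s, 0 <= s < t -> K° (x + s *: v)) ->
  (forall s, 0 <= s < t -> bform (D (x + s *: v)) v v <= C) ->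
  K° (x + t *: v).
Proof.
move=> t0 t1 Us HC; apply: contrapT => nK.
pose s_ (k : nat) : R := t * (1 - k.+1%:R^-1).
have s01 k : 0 <= s_ k < t.
  have k0 : 0 < k.+1%:R^-1 :> R by rewrite invr_gt0 ltr0n.
  have k1 : k.+1%:R^-1 <= 1 :> R by rewrite invf_le1 ?ltr0n // ler1n.
  apply/andP; split; first by apply: mulr_ge0; [exact: ltW|rewrite subr_ge0].
  by rewrite /s_ mulrBr mulr1 ltrBlDr ltrDl mulr_gt0.
have cvs : s_ @ \oo --> t.
  rewrite -[X in _ --> X]mulr1 -[X in _ * X](subr0 1).
  apply: cvgM; first exact: cvg_cst.
  by apply: cvgB; [exact: cvg_cst|exact: cvg_harmonic].
pose x_ (i : nat) := x + s_ i *: v.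
have Kx i : K° (x_ i) by apply: Us; exact: s01.
have cvx : x_ @ \oo --> x + t *: v.
  by apply: cvgD; [exact: cvg_cst|apply: cvgZr_tmp].
have closK : closed K by exact: compact_closed.
have Kt : (closure K `\` K°) (x + t *: v).
  split=> //; apply: subset_closure.
  have Kn : \forall k \near \oo, K (x_ k).
    by apply: nearW => k; apply: interior_subset.
  exact: (@closed_cvg _ _ _ _ x_ K closK Kn _ cvx).
have [_ _ /(_ x_ _ Kx cvx Kt) blow _] := sc.
pose B := Phi x + (`|dot v (gradient Phi x)| + `|C|).
have bnd (s : R) : 0 <= s < t -> Phi (x + s *: v) <= B.
  move=> /andP[s0 st].
  have lt_t (r : R) : 0 <= r <= s -> 0 <= r < t.
    by move=> /andP[-> /le_lt_trans]; apply.
  have [r rs e] := MVT01 s0 (fun r rs => is_derive_Phi_line (Us r (lt_t r rs))).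
  have /andP[r0 rles] := rs.
  have rsub (w : R) : 0 <= w <= r -> 0 <= w < t.
    by move=> /andP[w0 wr]; apply: lt_t; rewrite w0 (le_trans wr).
  have [w wr e'] := MVT01 r0 (fun w wr => is_derive_gradient_line v (Us w (rsub w wr))).
  rewrite !scale0r !addr0 in e e'.
  have b1 : dot v (gradient Phi (x + r *: v)) <= `|dot v (gradient Phi x)| + `|C|.
    rewrite -[leLHS](subrK (dot v (gradient Phi x))) e' addrC lerD ?ler_norm //.
    have r1 : r <= 1 by rewrite (le_trans rles) // ltW // (lt_le_trans st).
    have := HC w (rsub w wr); have := ler_norm C.
    have [_ p] := posH (Us w (rsub w wr)); have := p v; rewrite -/(bform _ _ _).
    set y := bform _ _ _; have := normr_ge0 C; nra.
  rewrite -[leLHS](subrK (Phi x)) e addrC lerD2l.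
  have s1 : s <= 1 by rewrite ltW // (lt_le_trans st).
  apply: le_trans (ler_wpM2l s0 b1) _.
  by rewrite ler_piMl // addr_ge0.
have /cvgryPgt/(_ B)[n _ /(_ n (leqnn n))] := blow.
by rewrite ltNge bnd.
Qed.

Lemma local_norm_small x v (t : R) : 0 <= t <= 1 -> M * N x v <= 1 / 25 ->
  (forall s, 0 <= s <= t -> K° (x + s *: v)) ->
  N (x + t *: v) v <= 1 / (24 * M).
Proof.
move=> /andP[t0 t1] small Us; have nx := mxnorm_ge0 (D x) v.
have r0 : 0 <= M * N x v by rewrite mulr_ge0 // ltW.
have rt : M * N x v * t <= 1 / 25 by rewrite (le_trans _ small) // ler_piMr.
have lt1 : M * N x v * t < 1 by lra.
apply: le_trans (local_norm_growth t0 lt1 Us) _.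
rewrite ler_pdivrMr ?subr_gt0 // mul1r ler_pdivlMl ?mulr_gt0 //; lra.
Qed.

(** A continuity argument on the largest time up to which the segment stays in the
    interior: [barrier_endpoint] puts the point reached at that time in the
    interior as well, and the interior is open. *)
Lemma dikin_segment x v : K° x -> M * N x v <= 1 / 25 ->
  forall t, 0 <= t <= 1 -> K° (x + t *: v).
Proof.
move=> Kx small; pose S : set R :=
  [set t | 0 <= t <= 1 /\ forall s, 0 <= s <= t -> K° (x + s *: v)].
have K0 : K° (x + 0 *: v) by rewrite scale0r addr0.
have S0 : S 0.
  split; first by rewrite lexx ler01.
  by move=> s; rewrite -eq_le => /eqP <-.
have supS : has_sup S.
  by split; [exists 0|exists 1 => t [/andP[]]].
have tau0 : 0 <= sup S by apply: (ub_le_sup supS.2).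
have tau1 : sup S <= 1 by apply: ge_sup => [|t [/andP[]]]; first by exists 0.
have below s : 0 <= s < sup S -> K° (x + s *: v).
  move=> /andP[s0 /(sup_gt supS.1)[t [_ St] st]].
  by apply: St; rewrite s0 ltW.
have Ktau : K° (x + sup S *: v).
  move: tau0; rewrite le_eqVlt => /orP[/eqP <- //|tau0].
  apply: (barrier_endpoint (C := (1 / (24 * M)) ^+ 2)) => // s /andP[s0 st].
  have Us r : 0 <= r <= s -> K° (x + r *: v).
    by move=> /andP[r0 /le_lt_trans rs]; apply: below; rewrite r0 rs.
  have Ks : K° (x + s *: v) by apply: Us; rewrite s0 lexx.
  rewrite -(sqr_mxnorm _ (posH Ks)) ler_sqr ?nnegrE ?mxnorm_ge0 //; last first.
    by rewrite divr_ge0 // mulr_ge0 // ltW.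
  by apply: local_norm_small => //; rewrite s0 ltW // (lt_le_trans st).
have tauS : S (sup S).
  split; first by rewrite tau0.
  move=> s /andP[s0]; rewrite le_eqVlt => /orP[/eqP -> //|st].
  by apply: below; rewrite s0.
suff tau_eq1 : sup S = 1 by move: tauS; rewrite tau_eq1 => -[].
apply/eqP; rewrite eq_le tau1 leNgt; apply/negP => tault1.
have cl : {for sup S, continuous (fun t : R => x + t *: v)}.
  by apply: continuousD; [exact: cst_continuous|exact: scalel_continuous].
have /cl/nbhs_ballP[e /= e0 he] : nbhs (x + sup S *: v) K°.
  exact: open_nbhs_nbhs.
pose t := Num.min 1 (sup S + e / 2).
have tt : sup S < t by rewrite lt_min tault1 ltrDl divr_gt0.
have : t <= sup S.
  apply: (ub_le_sup supS.2).
  split; first by rewrite (le_trans tau0 (ltW tt)) ge_min lexx.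
  move=> s /andP[s0 st]; have [ss|ss] := ltP s (sup S).
    by apply: below; rewrite s0.
  apply: he; rewrite -ball_normE /= distrC ger0_norm ?subr_ge0 //.
  have : t <= sup S + e / 2 by rewrite ge_min lexx orbT.
  lra.
by rewrite leNgt tt.
Qed.

Lemma dikin_segment_norm x v t : K° x -> M * N x v <= 1 / 25 -> 0 <= t <= 1 ->
  N (x + t *: v) v <= 1 / (24 * M).
Proof.
move=> Kx small t01; apply: local_norm_small => // s /andP[s0 st].
by apply: dikin_segment => //; rewrite s0 (le_trans st) //; case/andP: t01.
Qed.

(** By [self_concordant_third] the logarithm of [bform (D (x + t v)) h h] has slope at
    most [10 / 3 * M * 1 / (24 M) = 5 / 36], and [expR (5 / 36) <= 6 / 5]. *)
Lemma hessian_growth x v h :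
  (forall t, 0 <= t <= 1 -> K° (x + t *: v)) ->
  (forall t, 0 <= t <= 1 -> N (x + t *: v) v <= 1 / (24 * M)) ->
  bform (D (x + v)) h h <= 6 / 5 * bform (D x) h h.
Proof.
move=> Us Ns.
have dF (t : R) : 0 <= t <= 1 ->
    is_derive t 1 (fun s => bform (D (x + s *: v)) h h)
      (trilinear Phi (x + t *: v) v h h) /\
    trilinear Phi (x + t *: v) v h h <= 5 / 36 * bform (D (x + t *: v)) h h.
  move=> t01; split; first exact/is_derive_hessian_line/Us.
  apply: le_trans (ler_norm _) _; apply: le_trans (self_concordant_third v h (Us t t01)) _.
  rewrite sqr_mxnorm; last exact/posH/Us.
  apply: ler_wpM2r; first by have [_] := posH (Us t t01); apply.
  have := Ns t t01; rewrite ler_pdivlMr ?mulr_gt0 //; lra.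
have := @gronwall01 _ (fun s => bform (D (x + s *: v)) h h) _ _ dF.
rewrite scale1r scale0r addr0 => /le_trans; apply; apply: ler_wpM2r.
  have K0 := Us 0; rewrite scale0r addr0 lexx ler01 in K0.
  by have [_] := posH (K0 isT); apply.
have e0 := expR_gt0 (- (5 / 36) : R).
have := expR_ge1Dx (- (5 / 36) : R); have := expRxMexpNx_1 (5 / 36 : R).
have := expR_gt0 (5 / 36 : R); nra.
Qed.

(** Dikin's ellipsoid, with the comparison of Hessians on it. The converse bound is
    [hessian_growth] along the reversed segment, on which the local norm of the
    direction obeys the same bound. *)
Lemma dikin x y : K° x -> M * N x (y - x) <= 1 / 25 ->
  [/\ K° y, forall h, bform (D y) h h <= 6 / 5 * bform (D x) h h &
      forall h, bform (D x) h h <= 6 / 5 * bform (D y) h h].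
Proof.
move=> Kx small; have Us := dikin_segment Kx small.
have Ns t := dikin_segment_norm Kx small (t := t).
have xy : x + 1 *: (y - x) = y by rewrite scale1r addrC subrK.
split=> [|h|h].
- by rewrite -xy; apply: Us; rewrite ler01 lexx.
- by rewrite -{1}xy scale1r; exact: hessian_growth.
have back (t : R) : y + t *: (x - y) = x + (1 - t) *: (y - x).
  by rewrite -{1}xy -(opprB y x) scalerN scalerBl addrA.
have -> : D x = D (y + (x - y)) by congr D; rewrite addrC subrK.
apply: hessian_growth => t /andP[t0 t1]; rewrite back.
  by apply: Us; rewrite subr_ge0 t1 lerBlDr lerDl.
by rewrite mxnormB; apply: Ns; rewrite subr_ge0 t1 lerBlDr lerDl.
Qed.

(** * Minimizers of the barrier plus a linear function *)

Lemma gradient_MVT x y q : (forall t, 0 <= t <= 1 -> K° (x + t *: (y - x))) ->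
  exists2 t, 0 <= t <= 1 & dot q (gradient Phi y - gradient Phi x) =
    bform (D (x + t *: (y - x))) (y - x) q.
Proof.
move=> Us.
have [t t01] := MVT01 ler01 (fun s st => is_derive_gradient_line q (Us s st)).
rewrite scale0r addr0 scale1r subrKC mul1r => e; exists t => //.
by rewrite dotDr dotNr.
Qed.

Lemma convex_gradient x v : K° x -> K° v ->
  dot (v - x) (gradient Phi x) <= Phi v - Phi x.
Proof.
move=> Kx Kv; rewrite -subr_ge0.
have dF : is_derive (0 : R) 1
    (fun h : R => h * (Phi v - Phi x) - Phi (x + h *: (v - x)))
    ((Phi v - Phi x) - dot (v - x) (gradient Phi x)).
  apply: is_deriveB; last first.
    have x0E : x + 0 *: (v - x) = x by rewrite scale0r addr0.
    by have := @is_derive_Phi_line x (v - x) 0; rewrite x0E; apply.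
  have := @is_deriveM _ _ id (cst (Phi v - Phi x)) (0 : R) 1 _ _
    (is_derive_id _ _) (is_derive_cst _ _ _).
  by move=> dM; apply: (is_derive_eq dM); rewrite scaler0 add0r [LHS]mulr1.
apply: (derive_ge0_of_right_min dF ltr01) => h /andP[h0 h1].
rewrite scale0r addr0 mul0r sub0r.
have [/(_ (Itv01 (ltW h0) (ltW h1)) v x) + _ _ _] := sc.
rewrite !inE => /(_ Kv Kx); rewrite convRE /= /conv /=.
rewrite /unstable.onem => conv.
have -> : x + h *: (v - x) = h *: v + (1 - h) *: x.
  by rewrite scalerBl scale1r scalerBr addrCA.
lra.
Qed.

Lemma zero_gradient_minimum x s v : K° x -> K° v -> gradient Phi x + s = 0 ->
  Phi x + dot s x <= Phi v + dot s v.
Proof.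
move=> Kx Kv /eqP; rewrite addrC addr_eq0 => /eqP ->.
have := convex_gradient Kx Kv.
rewrite !dotNl dotC dotDr dotNr; lra.
Qed.

Lemma right_minimum_gradient x s q (e : R) : K° x -> 0 < e ->
  (forall h : R, 0 < h < e -> Phi x + dot s x <= Phi (x + h *: q) + dot s (x + h *: q)) ->
  0 <= dot q (gradient Phi x + s).
Proof.
move=> Kx e0 hmin.
have dF : is_derive (0 : R) 1 (fun h : R => Phi (x + h *: q) + h * dot s q)
    (dot q (gradient Phi x + s)).
  rewrite dotDr; apply: is_deriveD.
    have x0E : x + 0 *: q = x by rewrite scale0r addr0.
    by have := @is_derive_Phi_line x q 0; rewrite x0E; apply.
  have := @is_deriveM _ _ id (cst (dot s q)) (0 : R) 1 _ _
    (is_derive_id _ _) (is_derive_cst _ _ _).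
  by move=> dM; apply: (is_derive_eq dM); rewrite scaler0 add0r [LHS]mulr1 dotC.
apply: (derive_ge0_of_right_min dF e0) => h /hmin.
by rewrite dotDr dotZr scale0r addr0 mul0r addr0 addrCA addrC lerD2r addrC.
Qed.

Lemma interior_minimum_gradient x s : K° x ->
  (\forall y \near x, Phi x + dot s x <= Phi y + dot s y) ->
  gradient Phi x + s = 0.
Proof.
move=> Kx nmin; set q := gradient Phi x + s.
suff : 0 <= dot (- q) q.
  rewrite dotNl oppr_ge0 /dot mxE => le0.
  have sq (i : 'I_d) : 0 <= q^T 0 i * q i 0 by rewrite mxE -expr2 sqr_ge0.
  have /eqP : \sum_i q^T 0 i * q i 0 = 0 by apply/eqP; rewrite eq_le le0 sumr_ge0.
  rewrite psumr_eq0 // => /allP q0; apply/colP => i; rewrite [RHS]mxE.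
  by have := q0 i (mem_index_enum _); rewrite mxE mulf_eq0 orbb => /eqP.
have cl : {for 0, continuous (fun t : R => x + t *: (- q))}.
  by apply: continuousD; [exact: cst_continuous|exact: scalel_continuous].
have nx : \forall y \near x + 0 *: (- q), Phi x + dot s x <= Phi y + dot s y.
  by rewrite scale0r addr0.
have /cl/nbhs_ballP[e /= e0 he] := nx.
apply: (right_minimum_gradient Kx e0) => h /andP[h0 hle]; apply: he.
by rewrite -ball_normE /= sub0r normrN gtr0_norm.
Qed.

(** Compactness gives a minimizer over the Dikin ball of radius [1 / (25 M)] around
    [x]. The variational inequality towards the centre and strong convexity put
    it within [6 / 5 delta] of the centre, hence strictly inside the ball, so the
    gradient vanishes there. *)
Lemma nearby_minimizer x s (delta : R) : K° x ->
  mxnorm (invmx (D x)) (gradient Phi x + s) <= delta -> M * delta <= 1 / 100 ->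
  exists x', [/\ K° x', gradient Phi x' + s = 0 & N x (x' - x) <= 6 / 5 * delta].
Proof.
move=> Kx hdelta small; set r : R := 1 / (25 * M).
have r0 : 0 < r by rewrite divr_gt0 // mulr_gt0.
have Mr : M * r = 1 / 25 by rewrite /r; field; rewrite gt_eqF.
pose B : set 'cV[R]_d := [set y | N x (y - x) <= r].
have BK y : B y -> K° y.
  by move=> By; have [] := dikin Kx (_ : M * N x (y - x) <= 1 / 25);
    rewrite // -Mr ler_pM2l.
have BE : B = [set y | bform (D x) (y - x) (y - x) <= r ^+ 2].
  apply/seteqP; split=> y; rewrite /B /= -(sqr_mxnorm _ (posH Kx));
    by rewrite ler_sqr ?nnegrE ?mxnorm_ge0 // ltW.
have cn (y : 'cV[R]_d) : {for y, continuous (fun y => bform (D x) (y - x) (y - x))}.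
  apply: (continuous_comp (f := fun y => y - x) (g := fun y => bform (D x) y y)).
    by apply: continuousB => //; exact: cst_continuous.
  exact: bform_continuous.
have clB : closed B.
  rewrite BE; apply: (preimage_closed _ (@closed_le _ (r ^+ 2))) => y _.
  exact: cn.
have cB : compact B.
  by apply: (subclosed_compact clB cK) => y /BK/interior_subset.
have B0 : B x by rewrite /B /= subrr mxnorm0 ltW.
have cF : {within B, continuous (fun y => Phi y + dot s y)}.
  apply: continuous_in_subspaceT => y; rewrite inE => /BK Ky.
  apply: continuousD; last exact: dot_continuous.
  by case: C3 => + _; apply.
have [x' + xmin] := compact_EVT_min (ex_intro _ x B0) cB cF.
rewrite inE => Bx'; have Kx' := BK _ Bx'.
have segB (h : R) : 0 <= h <= 1 -> B (x + h *: (x' - x)).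
  move=> /andP[h0 h1]; rewrite /B /= addrC addKr mxnormZ ger0_norm //.
  by apply: le_trans Bx'; rewrite ler_piMl // mxnorm_ge0.
have vi : 0 <= dot (x - x') (gradient Phi x' + s).
  apply: (right_minimum_gradient Kx' ltr01) => h /andP[h0 h1].
  apply: xmin; rewrite inE.
  rewrite (_ : x' + h *: (x - x') = x + (1 - h) *: (x' - x)).
    by apply: segB; rewrite subr_ge0 ltW // lerBlDr lerDl ltW.
  by rewrite scalerBl scale1r addrA subrKC -scalerN opprB.
have [t t01 e] := gradient_MVT (x' - x) (fun t t01 => BK _ (segB t t01)).
have [_ _ lb] : [/\ K° (x + t *: (x' - x)),
   forall h, bform (D (x + t *: (x' - x))) h h <= 6 / 5 * bform (D x) h h &
   forall h, bform (D x) h h <= 6 / 5 * bform (D (x + t *: (x' - x))) h h].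
  by apply: dikin => //; rewrite -Mr ler_pM2l //; exact: segB.
have close : N x (x' - x) <= 6 / 5 * delta.
  have gE : gradient Phi x' - gradient Phi x =
      (gradient Phi x' + s) - (gradient Phi x + s) by rewrite opprD addrACA subrr addr0.
  apply: (strong_monotonicity_bound (p' := gradient Phi x' + s) (posdefH Kx) hdelta).
    by rewrite opprB.
  by rewrite -gE e; exact: lb.
exists x'; split=> //.
apply: interior_minimum_gradient => //.
have lt_r : N x (x' - x) < r.
  apply: le_lt_trans close _; rewrite /r ltr_pdivlMr ?mulr_gt0 //; lra.
have : \forall y \near x', bform (D x) (y - x) (y - x) < r ^+ 2.
  have : nbhs (bform (D x) (x' - x) (x' - x)) [set z : R | z < r ^+ 2].
    apply: open_nbhs_nbhs; split; first exact: open_lt.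
    by rewrite /= -(sqr_mxnorm _ (posH Kx)) ltr_sqr ?nnegrE ?mxnorm_ge0 // ltW.
  by move=> /(cn x').
apply: filterS => y /ltW By; apply: xmin.
have {}By : B y by rewrite BE; exact: By.
exact: mem_set.
Qed.

(** * Quasi-Newton steps with a fixed Hessian estimate *)

#[local] Opaque hessian gradient.

(** The region in which a run stays between two Hessian calls: the iterates are within
    [1 / (41 M)] of [u] when a round starts, and one round moves them, and the
    minimizer, by less than [1 / (200 M)]. *)
Lemma near_center u y H : K° u -> approximates H (D u) ->
  M * mxnorm H (y - u) <= 3 / 100 ->
  [/\ K° y, forall x, 4 / 5 * bform H x x <= bform (D y) x x <= 121 / 100 * bform H x x &
    forall x, bform H x x <= 121 / 100 * bform (D y) x x].
Proof.
move=> Ku [pH apx] small; have qH := posdef_possemidef pH.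
have uH : N u (y - u) <= 1001 / 1000 * mxnorm H (y - u).
  apply: (mxnorm_le (posH Ku) qH); first by lra.
  have /andP[+ _] := apx (y - u); have := possemidef_ge0 (y - u) (posH Ku).
  set a := bform _ _ _; set b := bform _ _ _; lra.
have MN : M * N u (y - u) <= 1 / 25.
  have := ler_wpM2l (ltW M0) uH; move: small; set a := mxnorm _ _; set b := mxnorm _ _; lra.
have [Ky yu uy] := dikin Ku MN.
have all x := hessian_sandwich_trans (apx x) (yu x) (uy x) (possemidef_ge0 x (posH Ku))
  (possemidef_ge0 x (posH Ky)).
by split; [exact: Ky|move=> x; exact: (all x).1|move=> x; exact: (all x).2].
Qed.

Lemma near_center_norms u y H x : K° u -> approximates H (D u) ->
  M * mxnorm H (y - u) <= 3 / 100 ->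
  N y x <= 11 / 10 * mxnorm H x /\ mxnorm H x <= 11 / 10 * N y x.
Proof.
move=> Ku apx small; have [Ky h1 h2] := near_center Ku apx small.
have qH := posdef_possemidef apx.1.
split.
  apply: (mxnorm_le (posH Ky) qH); first by lra.
  have /andP[_] := h1 x; set a := bform _ _ _; set b := bform _ _ _; lra.
apply: (mxnorm_le qH (posH Ky)); first by lra.
have := h2 x; set a := bform _ _ _; set b := bform _ _ _; lra.
Qed.

Lemma near_center_segment u x y H (t : R) : posdef H ->
  M * mxnorm H (x - u) <= 3 / 100 -> M * mxnorm H (y - u) <= 3 / 100 ->
  0 <= t <= 1 -> M * mxnorm H (x + t *: (y - x) - u) <= 3 / 100.
Proof.
move=> pH hx hy /andP[t0 t1].
have -> : x + t *: (y - x) - u = (1 - t) *: (x - u) + t *: (y - u).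
  by apply/colP => i; rewrite !mxE; ring.
have nle := mxnormD ((1 - t) *: (x - u)) (t *: (y - u)) (posdef_possemidef pH).
rewrite !mxnormZ !ger0_norm ?subr_ge0 // in nle.
have := ler_wpM2l (ltW M0) nle; move: hx hy.
set a := mxnorm _ _; set b := mxnorm _ _; set c := mxnorm _ _; nra.
Qed.

(** On the segment from [x] to [v] the estimate [H] is within a quarter of the true
    Hessian, hence the contraction factor; the gradient error costs its dual
    norm, measured in [H] instead of the Hessian at [v]. *)
Lemma inexact_newton_step u H x v s ghat (eps : R) : K° u -> approximates H (D u) ->
  M * mxnorm H (x - u) <= 3 / 100 -> M * mxnorm H (v - u) <= 3 / 100 ->
  gradient Phi x + s = 0 ->
  mxnorm (invmx (D v)) (ghat - gradient Phi v) <= eps ->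
  mxnorm H (v - invmx H *m (ghat + s) - x) <= 1 / 4 * mxnorm H (v - x) + 11 / 10 * eps.
Proof.
move=> Ku apx hx hv gx herr; have pH := apx.1; have qH := posdef_possemidef pH.
have [Kv _ _] := near_center Ku apx hv.
pose G := gradient Phi v - gradient Phi x; pose err := ghat - gradient Phi v.
have -> : v - invmx H *m (ghat + s) - x = (v - x - invmx H *m G) + - (invmx H *m err).
  have -> : s = - gradient Phi x by apply/eqP; rewrite -addr_eq0 addrC gx.
  have vec (a b c : 'cV[R]_d) : c - b = (a - b) + (c - a).
    by apply/colP => i; rewrite !mxE; ring.
  rewrite (vec (gradient Phi v) (gradient Phi x) ghat) mulmxDr -/G -/err.
  have vec2 (a b p q : 'cV[R]_d) : a - (p + q) - b = a - b - p + - q.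
    by apply/colP => i; rewrite !mxE; ring.
  exact: vec2.
apply: le_trans (mxnormD _ _ qH) _; rewrite mxnormN (mxnorm_inv _ pH); apply: lerD.
  have seg t : 0 <= t <= 1 -> K° (x + t *: (v - x)).
    by move=> /(near_center_segment pH hx hv)/(near_center Ku apx)[].
  have [t t01 e] := gradient_MVT (v - x - invmx H *m G) seg.
  have hxi := near_center_segment pH hx hv t01.
  have [Kxi b1 b2] := near_center Ku apx hxi.
  have dom y : `|bform (H - D (x + t *: (v - x))) y y| <= 1 / 4 * bform H y y.
    rewrite bformDm bformNm ler_norml.
    have /andP[] := b1 y; have := possemidef_ge0 y qH.
    set a := bform H _ _; set b := bform _ _ _ => h1 h2 h3.
    by apply/andP; split; lra.
  have k0 : 0 <= 1 / 4 :> R by lra.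
  exact: (newton_contraction (posH Kxi).1 pH k0 dom e).
apply: le_trans (ler_wpM2l _ herr); last by lra.
apply: (dual_mxnorm_le err (posdefH Kv) pH); first by lra.
by move=> y; exact: (near_center_norms y Ku apx hv).1.
Qed.

Implicit Types (H : 'M[R]_d) (u w s a b c gam : 'cV[R]_d) (t n k : nat).

Section Tracking.
Variables (eps : R) (Ograd : nat -> nat -> 'cV[R]_d -> 'cV[R]_d) (Cgrad : R).
Hypotheses (eps0 : 0 < eps) (epsM : M * eps <= 1 / 20000).
Hypothesis oracle : is_grad_oracle K Phi eps Ograd.

(** Started within [1 / (500 M)] of the minimizer [x], every iterate stays in the
    region around [u] where a step contracts by [1 / 4] up to an error [11 / 10 eps],
    so the errors accumulate to at most [3 / 2 eps]. *)
Lemma newton_converges t u H x s w n : K° u -> approximates H (D u) ->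
  gradient Phi x + s = 0 -> M * mxnorm H (x - u) <= 27 / 1000 ->
  M * mxnorm H (w - x) <= 2 / 1000 ->
  let v := (newton Ograd Cgrad t (invmx H) s w n).1 in
  mxnorm H (v - x) <= (1 / 4) ^+ n * mxnorm H (w - x) + 3 / 2 * eps /\
  M * mxnorm H (v - u) <= 3 / 100.
Proof.
move=> Ku apx gx hx hw /=; have pH := apx.1.
have pow01 k : 0 <= (1 / 4 : R) ^+ k <= 1.
  by rewrite exprn_ge0 ?exprn_ile1 //; lra.
have stay v k : mxnorm H (v - x) <= (1 / 4) ^+ k * mxnorm H (w - x) + 3 / 2 * eps ->
    M * mxnorm H (v - u) <= 3 / 100.
  move=> hv; have ch := mxnorm_triangle v x u pH.
  have h1 := ler_wpM2l (ltW M0) (le_trans ch (lerD hv (lexx _))).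
  have /andP[_ p1] := pow01 k.
  have w0 : 0 <= M * mxnorm H (w - x) by rewrite mulr_ge0 ?mxnorm_ge0 // ltW.
  have h2 := ler_wpM2r w0 p1.
  move: h1 h2 hx hw epsM; set a := mxnorm H (v - u); set b := mxnorm H (w - x).
  set c := mxnorm H (x - u); set p := _ ^+ k; lra.
suff main : mxnorm H ((newton Ograd Cgrad t (invmx H) s w n).1 - x) <=
    (1 / 4) ^+ n * mxnorm H (w - x) + 3 / 2 * eps by split=> //; exact: stay main.
elim: n => [|n IH]; first by rewrite expr0 mul1r lerDl; move: eps0; lra.
have hv := stay _ _ IH; have [Kv _ _] := near_center Ku apx hv.
have hx' : M * mxnorm H (x - u) <= 3 / 100 by apply: le_trans hx _; lra.
apply: le_trans (inexact_newton_step Ku apx hx' hv gx (oracle t n Kv)) _.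
move: IH; rewrite exprS; set a := mxnorm H _; set b := mxnorm H _; set p := _ ^+ n.
by move=> h; move: eps0; lra.
Qed.

(** One round. Let [x] and [x'] be the minimizers of [Phi + <s, .>] before and after
    the gradient step [gam]: strong convexity bounds their distance by the dual
    norm [e] of [gam], and as [x] minimizes the old objective the optimal value
    grows by at least [<gam, x'>], which is [<gam, w>] up to [O (eps e + e ^ 2)]. *)
Lemma round_tracking t u H x w s gam n (e := mxnorm (invmx (D w)) gam) :
  K° u -> approximates H (D u) -> M * mxnorm H (w - u) <= 1 / 41 ->
  K° x -> gradient Phi x + s = 0 -> mxnorm H (w - x) <= 2 * eps ->
  M * e <= 1 / 1000 -> (1 / 4) ^+ n <= eps * M ->
  let w' := (newton Ograd Cgrad t (invmx H) (s + gam) w n).1 in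
  exists x', [/\ K° x', gradient Phi x' + (s + gam) = 0,
    M * mxnorm H (w' - u) <= 3 / 100 & mxnorm H (w' - x') <= 151 / 100 * eps] /\
    (mxnorm H (w' - w) <= 4 * eps + 2 * e /\
    Phi x + dot s x + dot gam w <=
      Phi x' + dot (s + gam) x' + (22 / 10 * eps * e + 2 * e ^+ 2)).
Proof.
move=> Ku apx hwu Kx gx hwx he hn w'; have pH := apx.1.
have e0 : 0 <= e by exact: mxnorm_ge0.
(* 1 / 10000 bounds 2 M eps *)
have hxu : M * mxnorm H (x - u) <= 1 / 41 + 1 / 10000.
  have := ler_wpM2l (ltW M0) (mxnorm_triangle x w u pH).
  rewrite [in mxnorm H (x - w)]mxnormB.
  have := ler_wpM2l (ltW M0) hwx; move: hwu epsM.
  set a := mxnorm H (x - u); set b := mxnorm H (w - x); set c := mxnorm H (w - u); lra.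
have hx3 : M * mxnorm H (x - u) <= 3 / 100 by apply: le_trans hxu _; lra.
have hw3 : M * mxnorm H (w - u) <= 3 / 100 by apply: le_trans hwu _; lra.
have [Kw _ _] := near_center Ku apx hw3.
(* 121 / 100 = (11 / 10) ^ 2: from the norm at w to H, and from H to the norm at x *)
have dual_x : mxnorm (invmx (D x)) gam <= 121 / 100 * e.
  have k0 : 0 <= 121 / 100 :> R by lra.
  apply: (dual_mxnorm_le gam (posdefH Kw) (posdefH Kx) k0) => y.
  have [h1 _] := near_center_norms y Ku apx hw3; have [_ h2] := near_center_norms y Ku apx hx3.
  apply: le_trans h1 _.
  have -> : 121 / 100 * N x y = 11 / 10 * (11 / 10 * N x y) by field.
  by apply: ler_wpM2l h2; lra.
have grad_x : gradient Phi x + (s + gam) = gam by rewrite addrA gx add0r.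
have Mdelta : M * (121 / 100 * e) <= 1 / 100 by lra.
have [x' [Kx' gx' xx']] := nearby_minimizer (s := s + gam) Kx
  (eq_ind_r (fun y => mxnorm (invmx (D x)) y <= 121 / 100 * e) dual_x grad_x) Mdelta.
have xx'H : mxnorm H (x' - x) <= 8 / 5 * e.
  have [_ h] := near_center_norms (x' - x) Ku apx hx3.
  by apply: le_trans h _; move: xx'; set a := mxnorm _ _; lra.
have hx'u : M * mxnorm H (x' - u) <= 27 / 1000.
  have := ler_wpM2l (ltW M0) (mxnorm_triangle x' x u pH).
  have := ler_wpM2l (ltW M0) xx'H; move: hxu he.
  set a := mxnorm H (x' - u); set b := mxnorm H (x' - x); set c := mxnorm H (x - u); lra.
have hwx'0 : mxnorm H (w - x') <= 2 * eps + 8 / 5 * e.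
  apply: le_trans (mxnorm_triangle w x x' pH) _.
  by rewrite (mxnormB H x x'); apply: lerD.
have hwx' : M * mxnorm H (w - x') <= 2 / 1000.
  have := ler_wpM2l (ltW M0) hwx'0; move: epsM he; set a := mxnorm _ _; lra.
have [hw'x' hw'u] := newton_converges t n Ku apx gx' hx'u hwx'.
rewrite -/w' in hw'x' hw'u.
have {}hw'x' : mxnorm H (w' - x') <= 151 / 100 * eps.
  apply: le_trans hw'x' _.
  have h1 := ler_wpM2r (mxnorm_ge0 H (w - x')) hn.
  have h2 := ler_wpM2l (ltW eps0) hwx'.
  by move: h1 h2 eps0; set a := mxnorm _ _; set p := _ ^+ n; lra.
exists x'; split=> //; split.
  apply: le_trans (mxnorm_triangle w' x' w pH) _.
  have := hwx'0; rewrite (mxnormB H w x').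
  by move: hw'x' eps0; set a := mxnorm H _; set b := mxnorm H _; lra.
have mono := zero_gradient_minimum Kx Kx' gx.
have cs1 : dot gam (w - x) <= 22 / 10 * eps * e.
  apply: le_trans (dual_cauchy_schwarz _ _ (posdefH Kw)) _.
  have [h _] := near_center_norms (w - x) Ku apx hw3; rewrite -/e mulrC.
  apply: ler_wpM2r => //; apply: le_trans h _.
  by move: hwx; set a := mxnorm H _; lra.
have cs2 : dot gam (x - x') <= 2 * e ^+ 2.
  apply: le_trans (dual_cauchy_schwarz _ _ (posdefH Kx)) _.
  rewrite (mxnormB _ x x').
  apply: le_trans (ler_pM (mxnorm_ge0 _ _) (mxnorm_ge0 _ _) dual_x xx') _.
  by have := sqr_ge0 e; rewrite expr2; lra.
have -> : dot gam w = dot gam x' + dot gam (w - x) + dot gam (x - x').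
  by rewrite !dotDr !dotNr; ring.
rewrite dotDl; move: mono cs1 cs2; set a := dot _ _; set b := dot _ _; lra.
Qed.

End Tracking.

End SelfConcordant.

(** * Values and costs of the computations *)

Section Execution.
Context {R : realType} {d : nat}.
Variables (Ograd : nat -> nat -> 'cV[R]_d -> 'cV[R]_d)
  (Ohess : nat -> 'cV[R]_d -> 'M[R]_d * 'M[R]_d)
  (Cgrad Chess eta M : R) (mNewton : nat) (g : nat -> 'cV[R]_d).
Implicit Types (st : barons_state (R := R) (d := d)) (H : 'M[R]_d) (s w : 'cV[R]_d).

Lemma c_norm_value H w : (c_norm H w).1 = mxnorm H w.
Proof. by rewrite /c_norm /= mulmxA. Qed.

Lemma newton_cost t H s w n :
  (newton Ograd Cgrad t H s w n).2 =
    n%:R * (Cgrad + (d%:R + ((d * (2 * d - 1))%:R + d%:R))).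
Proof.
elim: n => [|n IH]; first by rewrite mul0r.
by rewrite /= IH -[n.+1]addn1 natrD mulrDl mul1r.
Qed.

Definition round_s t st := st_s st + eta *: g t.

Definition round_w t st :=
  (newton Ograd Cgrad t (st_Hinv st) (round_s t st) (st_w st) (mNewton - 1)).1.

Definition round_keep t st :=
  mxnorm (st_H st) (round_w t st - st_u st) <= 1 / (41 * M).

Lemma barons_round_value t st :
  (barons_round Ograd Ohess Cgrad Chess eta M mNewton g t st).1 =
  if round_keep t st
  then BaronsState (round_s t st) (round_w t st) (st_u st) (st_H st) (st_Hinv st)
  else BaronsState (round_s t st) (round_w t st) (round_w t st)
         (Ohess t.+1 (round_w t st)).1 (Ohess t.+1 (round_w t st)).2.
Proof.
rewrite /round_keep -c_norm_value /barons_round /cbind /=.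
by case: ifP.
Qed.

(** A quasi-Newton step takes [2 d ^ 2 + d] arithmetic operations and the rest of the
    round [2 d ^ 2 + 4 d + 1]; both are rounded up to multiples of [d ^ 2]. *)
Lemma barons_round_cost t st : (0 < d)%N -> 0 <= Cgrad ->
  (barons_round Ograd Ohess Cgrad Chess eta M mNewton g t st).2 <=
  (mNewton - 1)%:R * (Cgrad + 4 * d%:R ^+ 2) + 9 * d%:R ^+ 2 +
  (if round_keep t st then 0 else Chess).
Proof.
move=> d0 Cg0; rewrite /round_keep -c_norm_value /barons_round /cbind /=.
rewrite newton_cost; set D : R := d%:R.
have D1 : 1 <= D by rewrite ler1n.
have nE : (2 * d - 1)%:R = 2 * D - 1 :> R.
  by rewrite natrB ?natrM // muln_gt0.
rewrite natrM nE -/D; set n : R := (mNewton - 1)%:R.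
have n0 : 0 <= n by rewrite ler0n.
have DD : D <= D ^+ 2 by rewrite expr2 ler_peMl // (le_trans ler01).
have step : n * (Cgrad + (D + (D * (2 * D - 1) + D))) <= n * (Cgrad + 4 * D ^+ 2).
  by apply: ler_wpM2l => //; move: D1 DD; rewrite expr2; lra.
rewrite -/(c_norm (st_H st) _).
set k := if _ then _ else _; set k' := if _ then _ else _.
have -> : k.2 = k' by rewrite /k /k'; case: ifP => //=; rewrite addr0.
by move: D1 DD step; rewrite expr2; set q := n * _; set q' := n * _; lra.
Qed.

End Execution.

(** * Numerical constants *)

Section Constants.
Context {R : realType}.

Lemma expRN1_ge : 1 / 4 <= expR (- 1 : R).
Proof.
have -> : - 1 = - (1 / 2) + - (1 / 2) :> R by lra.
by rewrite expRD; have := expR_ge1Dx (- (1 / 2) : R); nra.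
Qed.

(** Each step gains a factor [1 / 4 <= expR (- 1)], so [ln (1 / q)] steps suffice; the
    factor [2] pays for the [m - 1] in the number of steps. *)
Lemma newton_iterations_suffice (q : R) (m : nat) : 0 < q -> q <= 1 / 20000 ->
  2 * ln (1 / q) <= m%:R -> 1 <= ln (1 / q) /\ (1 / 4) ^+ (m - 1) <= q.
Proof.
move=> q0 q1; have Eq : expR (- ln (1 / q)) = q.
  by rewrite expRN lnK ?posrE ?divr_gt0 // invf_div divr1.
have L1 : 1 <= ln (1 / q).
  rewrite -lerN2 -ler_expR Eq; apply: le_trans expRN1_ge; lra.
move=> hm; split=> //; have m1 : (1 <= m)%N.
  by rewrite -(ler_nat R) (le_trans _ hm) //; lra.
have hn : ln (1 / q) <= (m - 1)%:R by rewrite natrB //; lra.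
apply: (@le_trans _ _ (expR (- 1) ^+ (m - 1))).
  by apply: lerXn2r; rewrite ?nnegrE ?expR_ge0 ?expRN1_ge //; lra.
by rewrite -expRM_natl mulrN1 -[leRHS]Eq ler_expR lerN2.
Qed.

End Constants.

Section Arithmetic.
Context {R : realType}.

Lemma le_div_scaled (k M x : R) : 0 < k -> 0 < M -> x <= 1 / (k * M) -> M * x <= 1 / k.
Proof.
by move=> k0 M0; rewrite !ler_pdivlMr ?mulr_gt0 // (_ : M * x * k = x * (k * M)) //; ring.
Qed.

Lemma optimal_value_balance (fs sg fx err fv q : R) :
  fs + sg <= fx + err -> fx <= fv + q -> sg - q <= fv - fs + err.
Proof. lra. Qed.

Lemma regret_arithmetic (eta eps c2 p B B2 S : R) : 0 < eta -> 0 < eps -> 0 <= p ->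
  0 <= B -> 0 <= B2 -> 2 <= c2 ->
  eta * S <= p + eta * (22 / 10 * eps * B + 2 * eta * B2) ->
  S <= (4 * c2 + 200) * (1 / eta * p + eta * B2 + eps * B).
Proof.
move=> eta0 eps0 p0 B0 B20 hc h.
have x0 : 0 <= 1 / eta * p by rewrite mulr_ge0 ?divr_ge0 // ltW.
have y0 : 0 <= eta * B2 by rewrite mulr_ge0 // ltW.
have z0 : 0 <= eps * B by rewrite mulr_ge0 // ltW.
have : S <= 1 / eta * p + (22 / 10 * (eps * B) + 2 * (eta * B2)).
  rewrite -(ler_pM2l eta0); apply: le_trans h _.
  by rewrite le_eqVlt; apply/orP; left; apply/eqP; field; rewrite gt_eqF.
move=> /le_trans; apply.
move: x0 y0 z0; set x := 1 / eta * p; set y := eta * B2; set z := eps * B => x0 y0 z0.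
have : 200 * (x + y + z) <= (4 * c2 + 200) * (x + y + z).
  by apply: ler_wpM2r; [rewrite !addr_ge0|lra].
by move=> /(le_trans _); apply; lra.
Qed.

Lemma cost_arithmetic (cost X Chess Cg D2 n c2 L T M eps B : R) :
  0 <= X -> 0 <= Chess -> 0 <= Cg -> 0 <= D2 -> 0 <= T -> 0 <= M -> 0 <= eps ->
  0 <= B -> 2 <= c2 -> 1 <= L -> n <= c2 * L ->
  cost + X <= Chess + T * (n * (Cg + 4 * D2) + 9 * D2) +
     Chess * (41 * M * (T * (4 * eps) + 2 * B)) ->
  cost <= Chess + (4 * c2 + 200) * ((Cg + D2) * T * L + Chess * (M * T * eps + M * B)).
Proof.
move=> X0 Ch0 Cg0 D0 T0 M0 e0 B0 hc L1 hn h.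
have round : n * (Cg + 4 * D2) + 9 * D2 <= (4 * c2 + 200) * ((Cg + D2) * L).
  have h1 : n * (Cg + 4 * D2) <= c2 * L * (4 * (Cg + D2)).
    apply: (@le_trans _ _ (c2 * L * (Cg + 4 * D2))).
      by apply: ler_wpM2r => //; lra.
    by apply: ler_wpM2l; [rewrite mulr_ge0 //; lra|lra].
  have h2 : Cg + D2 <= (Cg + D2) * L by rewrite ler_peMr // addr_ge0.
  by lra.
have hess : 41 * M * (T * (4 * eps) + 2 * B) <= (4 * c2 + 200) * (M * T * eps + M * B).
  have t0 : 0 <= M * T * eps by rewrite !mulr_ge0.
  have b0 : 0 <= M * B by rewrite mulr_ge0.
  have : 200 * (M * T * eps + M * B) <= (4 * c2 + 200) * (M * T * eps + M * B).
    by apply: ler_wpM2r; [rewrite addr_ge0|lra].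
  by lra.
have := ler_wpM2l T0 round; have := ler_wpM2l Ch0 hess; lra.
Qed.

End Arithmetic.

(** * The invariant of a run *)

Lemma barons_runS {R : realType} {d : nat} Ograd Ohess (Cgrad Chess eta M : R) mNewton
    wstar g t (run := barons_run (d := d) Ograd Ohess Cgrad Chess eta M mNewton wstar g) :
  (run t.+1).1 = (barons_round Ograd Ohess Cgrad Chess eta M mNewton g t (run t).1).1 /\
  (run t.+1).2 = (run t).2 +
    (barons_round Ograd Ohess Cgrad Chess eta M mNewton g t (run t).1).2.
Proof. by []. Qed.

#[local] Opaque newton barons_round barons_run barons_iterate.

Section Invariant.
Context {R : realType} {d : nat} (K : set 'cV[R]_d) (Phi : 'cV[R]_d -> R) (M eta eps : R).
Context (mNewton : nat) (Ograd : nat -> nat -> 'cV[R]_d -> 'cV[R]_d)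
    (Ohess : nat -> 'cV[R]_d -> 'M[R]_d * 'M[R]_d)
    (Cgrad Chess : R) (wstar : 'cV[R]_d) (g : nat -> 'cV[R]_d).
Hypotheses (M0 : 0 < M) (cK : compact K) (sc : self_concordant K Phi M).
Hypotheses (eps0 : 0 < eps) (epsM : M * eps <= 1 / 20000) (eta0 : 0 < eta).
Hypotheses (gradO : is_grad_oracle K Phi eps Ograd)
  (hessO : is_hess_oracle K Phi (1 / 1000) Ohess).
Hypotheses (Cg0 : 0 <= Cgrad) (Ch0 : 0 <= Chess) (d0 : (0 < d)%N).
Hypothesis few_steps : (1 / 4) ^+ (mNewton - 1) <= eps * M.

Local Notation run := (barons_run Ograd Ohess Cgrad Chess eta M mNewton wstar g).
Local Notation w_ := (barons_iterate Ograd Ohess Cgrad Chess eta M mNewton wstar g).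

(** Up to a constant, this bounds how far the exact minimizer moves in round [i]. *)
Definition local_step_norm i := eta * dual_norm Phi (w_ i) (g i).
Local Notation e_ := local_step_norm.

Lemma hess_oracle_approximates t w : K° w ->
  approximates (Ohess t w).1 (hessian Phi w) /\ (Ohess t w).2 = invmx (Ohess t w).1.
Proof.
move=> Kw; have := hessO t Kw; case: (Ohess t w) => H Hinv /= [HH lo hi _ _].
have a01 : (0 < 1 / 1000 :> R) && (1 / 1000 < 1 :> R) by apply/andP; split; lra.
have [_ pH ->] := sandwich_posdef a01 HH lo hi.
split=> //; split=> // x; have := loewner_leP lo x; have := loewner_leP hi x.
rewrite !bformZm; set a := bform _ _ _; set b := bform _ _ _ => h1 h2.
by apply/andP; split; lra.
Qed.

Lemma hessian_posdef x : K° x -> posdef (hessian Phi x).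
Proof.
move=> Kx; have := hessO 0 Kx; case: (Ohess 0 x) => H Hinv [HH lo hi _ _].
have a01 : (0 < 1 / 1000 :> R) && (1 / 1000 < 1 :> R) by apply/andP; split; lra.
by have [] := sandwich_posdef a01 HH lo hi.
Qed.

(** [x] is the exact minimizer that the state tracks. The optimal value of its
    objective dominates the learner's linearized loss up to the accumulated
    tracking errors; this is the whole regret bound. *)
Definition tracks (t : nat) (x : 'cV[R]_d) (st : barons_state) : Prop :=
  [/\ K° (st_u st), approximates (st_H st) (hessian Phi (st_u st)) &
      st_Hinv st = invmx (st_H st)] /\
  [/\ K° x, gradient Phi x + st_s st = 0,
      M * mxnorm (st_H st) (st_w st - st_u st) <= 1 / 41 &
      mxnorm (st_H st) (st_w st - x) <= 2 * eps] /\
  [/\ st_s st = \sum_(i < t) eta *: g i &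
      Phi wstar + \sum_(i < t) dot (eta *: g i) (w_ i) <=
      Phi x + dot (st_s st) x + \sum_(i < t) (22 / 10 * eps * e_ i + 2 * e_ i ^+ 2)].

(** The number of Hessian calls plus [41 M ||w - u||_H] is a potential. It grows by at
    most [41 M] times the distance travelled by [w], and a call, made only when the
    second term exceeds [1], resets that term to [0]. *)
Lemma round_tracks t x st : st_w st = w_ t -> tracks t x st ->
  M * e_ t <= 1 / 1000 ->
  let st' := (barons_round Ograd Ohess Cgrad Chess eta M mNewton g t st).1 in
  (exists x', tracks t.+1 x' st') /\
  (if round_keep Ograd Cgrad eta M mNewton g t st then 0 else 1) +
    41 * M * mxnorm (st_H st') (st_w st' - st_u st') <=
  41 * M * mxnorm (st_H st) (st_w st - st_u st) + 41 * M * (4 * eps + 2 * e_ t).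
Proof.
move=> wE [[Ku apx HE] [[Kx gx hwu hwx] [sE pot]]] he st'.
have eE : mxnorm (invmx (hessian Phi (st_w st))) (eta *: g t) = e_ t.
  by rewrite mxnormZ (gtr0_norm eta0) /local_step_norm -wE.
have he' : M * mxnorm (invmx (hessian Phi (st_w st))) (eta *: g t) <= 1 / 1000.
  by rewrite eE.
have [x' [[Kx' gx' hw'u hw'x'] [hw'w grow]]] := round_tracking M0 cK sc
  hessian_posdef Cgrad eps0 epsM gradO t Ku apx hwu Kx gx hwx he' few_steps.
rewrite -HE -/(round_s eta g t st) -/(round_w Ograd Cgrad eta mNewton g t st) in
  gx' hw'u hw'x' hw'w grow.
set s' := round_s eta g t st in gx' grow *.
have stE : st' = _ := barons_round_value Ograd Ohess Cgrad Chess eta M mNewton g t st.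
set w' := round_w Ograd Cgrad eta mNewton g t st in hw'u hw'x' hw'w stE.
rewrite eE in hw'w grow.
have s'E : s' = \sum_(i < t.+1) eta *: g i.
  by rewrite big_ord_recr /= -sE.
have pot' : Phi wstar + \sum_(i < t.+1) dot (eta *: g i) (w_ i) <=
    Phi x' + dot s' x' + \sum_(i < t.+1) (22 / 10 * eps * e_ i + 2 * e_ i ^+ 2).
  rewrite !big_ord_recr /= -wE.
  rewrite -/(round_s eta g t st) -/s' in grow.
  move: pot grow.
  set S1 := \sum_(i < t) _; set S2 := \sum_(i < t) _; set D1 := dot _ (st_w st).
  set D2 := dot _ x; set D3 := dot _ x'; set E := _ + 2 * _; lra.
have pH := apx.1.
have move_w : M * mxnorm (st_H st) (w' - st_u st) <=
    M * mxnorm (st_H st) (st_w st - st_u st) + M * (4 * eps + 2 * e_ t).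
  rewrite -mulrDr; apply: (ler_wpM2l (ltW M0)).
  by apply: le_trans (mxnorm_triangle w' (st_w st) (st_u st) pH) _; rewrite addrC lerD2l.
rewrite stE; case: ifPn => keep /=.
  split; last by rewrite add0r; move: move_w;
    set a := mxnorm _ _; set b := mxnorm _ _; set c := _ + 2 * _; lra.
  exists x'; split=> //; split; last by [].
  split=> //; last by apply: le_trans hw'x' _; move: eps0; lra.
  move: keep; rewrite /round_keep -/w' ler_pdivlMr ?mulr_gt0 //.
  by set a := mxnorm _ _; lra.
have [Kw' _ _] := near_center M0 cK sc hessian_posdef Ku apx hw'u.
have [apx' inv'] := hess_oracle_approximates t.+1 Kw'.
split; last first.
  rewrite subrr mxnorm0 mulr0 addr0.
  move: keep move_w; rewrite /round_keep -/w' -ltNge ltr_pdivrMr ?mulr_gt0 //.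
  by set a := mxnorm _ _; set b := mxnorm _ _; set c := _ + 2 * _; lra.
exists x'; split; first by split.
split; last by [].
split=> //; first by rewrite subrr mxnorm0 mulr0; lra.
have [near_u _] := near_center_norms M0 cK sc hessian_posdef (w' - x') Ku apx hw'u.
have norm' : mxnorm (Ohess t.+1 w').1 (w' - x') <= 1001 / 1000 * mxnorm (hessian Phi w') (w' - x').
  have qD := posdef_possemidef (hessian_posdef Kw').
  apply: (mxnorm_le (posdef_possemidef apx'.1) qD); first by lra.
  have /andP[_] := apx'.2 (w' - x'); have := possemidef_ge0 (w' - x') qD.
  by set a := bform _ _ _; set b := bform _ _ _; lra.
move: near_u norm' hw'x' eps0.
by set a := mxnorm _ _; set b := mxnorm _ _; set c := mxnorm _ _; lra.
Qed.

Hypothesis wmin : is_minimizer K Phi wstar.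

Lemma init_tracks : tracks 0 wstar (run 0).1.
Proof.
have [Kw min] := wmin.
have -> : (run 0).1 = BaronsState 0 wstar wstar (Ohess 0 wstar).1 (Ohess 0 wstar).2.
  by [].
have [apx inv] := hess_oracle_approximates 0 Kw.
split; first by split.
split; last first.
  by rewrite !big_ord0; split=> //=; rewrite dot0l !addr0.
split=> /=.
- exact: Kw.
- apply: (interior_minimum_gradient sc Kw).
  have : \forall y \near wstar, K° y by apply: open_nbhs_nbhs; split; [exact: open_interior|].
  by apply: filterS => y /min; rewrite !dot0l !addr0.
- by rewrite subrr mxnorm0 mulr0; lra.
- by rewrite subrr mxnorm0 mulr_ge0 // ltW.
Qed.

Lemma run_tracks (T : nat) : (forall t, (t < T)%N -> M * e_ t <= 1 / 1000) ->
  forall t, (t <= T)%N -> (exists x, tracks t x (run t).1) /\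
  (run t).2 + Chess * (41 * M * mxnorm (st_H (run t).1) (st_w (run t).1 - st_u (run t).1))
   <= Chess + t%:R * ((mNewton - 1)%:R * (Cgrad + 4 * d%:R ^+ 2) + 9 * d%:R ^+ 2) +
     Chess * (41 * M * \sum_(i < t) (4 * eps + 2 * e_ i)).
Proof.
move=> he; elim=> [|t IH] tT.
  split; first by exists wstar; exact: init_tracks.
  have -> : (run 0) = (BaronsState 0 wstar wstar (Ohess 0 wstar).1 (Ohess 0 wstar).2,
    Chess + 0) by [].
  by rewrite /= subrr mxnorm0 big_ord0 !mulr0 mul0r !addr0.
have [[x tr] cost] := IH (ltnW tT).
have wE : st_w (run t).1 = w_ t by [].
have [tr' pot] := round_tracks wE tr (he t tT).
have [run1 run2] := barons_runS Ograd Ohess Cgrad Chess eta M mNewton wstar g t.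
have rc := barons_round_cost Ograd Ohess Chess eta M mNewton g t (run t).1 d0 Cg0.
rewrite run1 run2; split; first exact: tr'.
rewrite big_ord_recr /= -[in t.+1%:R](addn1 t) natrD.
have cpot := ler_wpM2l Ch0 pot.
move: cost rc cpot; rewrite (_ : (if _ then 0 else Chess) = Chess *
  (if round_keep Ograd Cgrad eta M mNewton g t (run t).1 then 0 else 1)); last first.
  by case: ifP; rewrite ?mulr0 ?mulr1.
set k := if _ then _ else _; set c := (run t).2; set c' := (barons_round _ _ _ _ _ _ _ _ _ _).2.
set n := mxnorm _ _; set n' := mxnorm _ _; set S := \sum_(i < t) _; set A := _ + 9 * _.
set E := 4 * eps + _; lra.
Qed.

End Invariant.

(** * The regret and cost bounds *)

Theorem theorem5 (R : realType) :
  exists c1 : R, 0 < c1 /\ forall c2 : R, c1 <= c2 ->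
  exists C : R, 0 < C /\
  forall (d : nat) (K : set 'cV[R]_d) (Phi : 'cV[R]_d -> R)
    (M b eta eps alpha : R) (mNewton : nat)
    (Ograd : nat -> nat -> 'cV[R]_d -> 'cV[R]_d)
    (Ohess : nat -> 'cV[R]_d -> 'M[R]_d * 'M[R]_d)
    (Cgrad Chess : R) (wstar : 'cV[R]_d) (T : nat)
    (l : nat -> 'cV[R]_d -> R) (g : nat -> 'cV[R]_d),
  (0 < d)%N ->
  convex_set K -> compact K -> K° !=set0 ->
  0 < M -> self_concordant K Phi M ->
  0 < b -> 0 < eta -> 0 < eps -> 0 < alpha ->
  eta <= 1 / (1000 * b * M) ->
  eps <= 1 / (20000 * M) ->
  alpha = 1 / 1000 ->
  c1 * ln (1 / (eps * M)) <= mNewton%:R <= c2 * ln (1 / (eps * M)) ->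
  is_grad_oracle K Phi eps Ograd -> is_hess_oracle K Phi alpha Ohess ->
  0 <= Cgrad -> 0 <= Chess ->
  is_minimizer K Phi wstar ->
  let w := barons_iterate Ograd Ohess Cgrad Chess eta M mNewton wstar g in
  (forall t, (t < T)%N ->
    [/\ convex_function K (l t),
        subgradient K (l t) (w t) (g t) &
        dual_norm Phi (w t) (g t) <= b]) ->
  (forall v, K° v ->
    \sum_(t < T) (l t (w t) - l t v) <=
      C * (1 / eta * (Phi v - Phi wstar)
           + eta * \sum_(t < T) dual_norm Phi (w t) (g t) ^+ 2
           + eps * \sum_(t < T) dual_norm Phi (w t) (g t))) /\
  barons_cost Ograd Ohess Cgrad Chess eta M mNewton wstar g T <=
    Chess +
    C * ((Cgrad + d%:R ^+ 2) * T%:R * ln (1 / (eps * M))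
         + Chess * (M * T%:R * eps
                    + M * \sum_(t < T) eta * dual_norm Phi (w t) (g t))).

Proof.
exists 2; split=> // c2 hc2; exists (4 * c2 + 200); split; first by lra.
move=> d K Phi M b eta eps alpha mNewton Ograd Ohess Cgrad Chess wstar T l g.
move=> d0 _ cK _ M0 sc b0 eta0 eps0 _ hetab heps -> /andP[hm1 hm2] gO hO Cg0 Ch0 wmin w hyp.
have epsM : M * eps <= 1 / 20000.
  by apply: le_div_scaled M0 heps; rewrite ltr0n.
have q0 : 0 < eps * M by rewrite mulr_gt0.
have q1 : eps * M <= 1 / 20000 by rewrite mulrC.
have [L1 few] := newton_iterations_suffice q0 q1 hm1.
pose e_ := local_step_norm Phi M eta mNewton Ograd Ohess Cgrad Chess wstar g.
have he t : (t < T)%N -> M * e_ t <= 1 / 1000.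
  move=> /hyp[_ _ gb]; have := ler_wpM2l (ltW eta0) gb.
  rewrite -[eta * dual_norm _ _ _]/(e_ t) => h.
  apply: le_trans (ler_wpM2l (ltW M0) h) _; rewrite mulrA mulrC.
  apply: (le_div_scaled _ b0); first by rewrite ltr0n.
  have k0 : 0 < 1000 :> R by rewrite ltr0n.
  exact: (le_div_scaled (mulr_gt0 k0 b0) M0 hetab).
have [[x tr] cost] := run_tracks M0 cK sc eps0 epsM eta0 gO hO Cg0 Ch0 d0 few wmin he (leqnn T).
have [_ [[Kx gx _ _] [sE pot]]] := tr.
pose B := \sum_(t < T) dual_norm Phi (w t) (g t).
pose B2 := \sum_(t < T) dual_norm Phi (w t) (g t) ^+ 2.
have B_ge0 : 0 <= B by apply: sumr_ge0 => t _; exact: mxnorm_ge0.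
have B2_ge0 : 0 <= B2 by apply: sumr_ge0 => t _; exact: sqr_ge0.
split.
- move=> v Kv; rewrite -/B -/B2.
  have lin : \sum_(t < T) (l t (w t) - l t v) <= \sum_(t < T) dot (g t) (w t - v).
    apply: ler_sum => t _; have [_ sub _] := hyp t (ltn_ord t).
    have := sub v (interior_subset Kv); rewrite -/(dot _ _) -(opprB (w t) v) dotNr.
    by rewrite lerBlDr [leRHS]addrC -lerBlDr.
  apply: le_trans lin _.
  have opt := zero_gradient_minimum sc Kx Kv gx.
  have errE : \sum_(i < T) (22 / 10 * eps * e_ i + 2 * e_ i ^+ 2) =
      eta * (22 / 10 * eps * B + 2 * eta * B2).
    rewrite big_split /= /B /B2 mulrDr; congr (_ + _).
      by rewrite !big_distrr /=; apply: eq_bigr => i _; rewrite /e_ /local_step_norm; ring.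
    by rewrite !big_distrr /=; apply: eq_bigr => i _; rewrite /e_ /local_step_norm; ring.
  have sumE : eta * \sum_(t < T) dot (g t) (w t - v) =
      \sum_(i < T) dot (eta *: g i) (w i) - dot (st_s (barons_run Ograd Ohess Cgrad Chess eta M mNewton wstar g T).1) v.
    rewrite sE big_distrr /=.
    have -> : dot (\sum_(i < T) eta *: g i) v = \sum_(i < T) dot (eta *: g i) v.
      elim/big_rec2 : _ => [|i y z _ IH]; first exact: dot0l.
      by rewrite dotDl IH.
    rewrite -sumrB; apply: eq_bigr => i _.
    by rewrite dotDr dotNr mulrBr -!dotZl.
  have min0 : 0 <= Phi v - Phi wstar by rewrite subr_ge0; exact: wmin.2.
  have main : eta * \sum_(t < T) dot (g t) (w t - v) <=
      Phi v - Phi wstar + eta * (22 / 10 * eps * B + 2 * eta * B2).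
    by rewrite sumE -errE; exact: optimal_value_balance pot opt.
  exact: (regret_arithmetic eta0 eps0 min0 B_ge0 B2_ge0 hc2 main).
- have SE : \sum_(i < T) (4 * eps + 2 * e_ i) =
      T%:R * (4 * eps) + 2 * \sum_(t < T) eta * dual_norm Phi (w t) (g t).
    rewrite big_split /= sumr_const card_ord -[X in X + _ = _]mulr_natl.
    by rewrite big_distrr.
  rewrite SE in cost.
  have Be0 : 0 <= \sum_(t < T) eta * dual_norm Phi (w t) (g t).
    by apply: sumr_ge0 => t _; rewrite mulr_ge0 ?mxnorm_ge0 // ltW.
  have nm : (mNewton - 1)%:R <= c2 * ln (1 / (eps * M)).
    by apply: le_trans hm2; rewrite ler_nat leq_subr.
  apply: (cost_arithmetic _ Ch0 Cg0 (sqr_ge0 _) (ler0n _ _) (ltW M0) (ltW eps0) Be0 hc2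
    L1 nm cost).
  by rewrite mulr_ge0 // mulr_ge0 ?mxnorm_ge0 // mulr_ge0 // ltW.
Qed.
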